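(* Let $X,Y,Z$ be locally convex Hausdorff topological vector spaces, $K\subset Y$ a proper closed convex cone with $\operatorname{int}K\neq\emptyset$, and $S\subset Z$ a nonempty convex cone. Let $\Phi\colon X\times Z\to Y^\infty$ be a proper $K$-convex mapping with $0_Z\in\pi(\operatorname{dom}\Phi)$, where $\pi(x,z)=z$, and let $Z_0=\operatorname{lin}(\pi(\operatorname{dom}\Phi))$ with the induced topology. Assume that at least one of the following conditions holds: (i) there exist $(\widehat x,\widehat y)\in X\times Y$ and a neighborhood $\widehat V$ of $0_Z$ such that $\Phi(\widehat x,z)\leqq_K\widehat y$ for all $z\in\widehat V\cap Z_0$; (ii) there exists $\widehat x\in X$ such that the restriction of $\Phi(\widehat x,\cdot)$ to $Z_0$ is continuous at $0_Z$; (iii) $\dim Z_0<\infty$ and $0_Z\in\operatorname{ri}(\pi(\operatorname{dom}\Phi))$; (iv) $X,Y$ are complete and first countable, $Z_0$ is barreled, $\Phi$ is $K$-epi closed, and $0_Z\in\operatorname{icr}(\pi(\operatorname{dom}\Phi))$; (v) $\Phi(x,0_Z)\leqq_K\Phi(x,z)$ for all $(x,z)\in\operatorname{dom}\Phi$, and $\operatorname{int}(\pi(\operatorname{dom}\Phi))\neq\emptyset$. Then $$\operatorname{epi}\Phi(\cdot,0_Z)^*=\bigcup_{T\in\mathcal L_\Phi}\operatorname{epi}\Phi^*(\cdot,T).$$ Moreover, if in addition there exists $\tilde x\in X$ with $(\tilde x,0_Z)\in\operatorname{dom}\Phi$ and $\Phi(\tilde x,z)\leqq_K\Phi(\tilde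 x,0_Z)$ for all $z\in-S$, then $$\operatorname{epi}\Phi(\cdot,0_Z)^*=\bigcup_{T\in\mathcal L_\Phi}\operatorname{epi}\Phi^*(\cdot,T)=\bigcup_{T\in\mathcal L_\Phi^+}\operatorname{epi}\Phi^*(\cdot,T).$$
   Context: Ordering: $K$ proper means $K\ne Y$. $y_1\leqq_K y_2$ iff $y_1-y_2\in-K$; $y_1<_K y_2$ iff $y_1-y_2\in-\operatorname{int}K$. $Y^\infty=Y\cup\{+\infty_Y\}$, $Y^\bullet=Y\cup\{-\infty_Y,+\infty_Y\}$, where $-\infty_Y<_K y<_K+\infty_Y$ for $y\in Y$, $-\infty_Y<_K+\infty_Y$, $-(+\infty_Y)=-\infty_Y$, $y+(\pm\infty_Y)=\pm\infty_Y$ for $y\in Y$; in particular $+\infty_Y\not\leqq_K y$ for $y\in Y$. Weak supremum: for $M\subset Y^\bullet$, $\operatorname{WSup}M$ is the set of $\bar v\in Y^\bullet$ such that $\bar v\not<_K v$ for all $v\in M$ and for every $\tilde v\in Y^\bullet$ with $\tilde v<_K\bar v$ there is $v\in M$ with $\tilde v<_K v$. $\mathcal L(X,Y)$ is the space of continuous linear maps $X\to Y$. For $\Phi\colon X\times Z\to Y^\infty$: $\operatorname{dom}\Phi=\{(x,z):\Phi(x,z)\neq+\infty_Y\}$; $\Phi$ is proper if $\operatorname{dom}\Phi\ne\emptyset$; $\Phi$ is $K$-convex (resp. $K$-epi closed) if $\{(x,z,y)\in X\times Z\times Y:y\in\Phi(x,z)+K\}$ is convex (resp. closed). Conjugates: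 $\Phi^*(L,T)=\operatorname{WSup}\{L(x)+T(z)-\Phi(x,z):(x,z)\in X\times Z\}$ for $(L,T)\in\mathcal L(X,Y)\times\mathcal L(Z,Y)$; $\Phi(\cdot,0_Z)^*(L)=\operatorname{WSup}\{L(x)-\Phi(x,0_Z):x\in X\}$. $\operatorname{epi}\Phi(\cdot,0_Z)^*=\{(L,y)\in\mathcal L(X,Y)\times Y:y\in\Phi(\cdot,0_Z)^*(L)+K\}$ and $\operatorname{epi}\Phi^*(\cdot,T)=\{(L,y)\in\mathcal L(X,Y)\times Y:y\in\Phi^*(L,T)+K\}$ (where $\{\pm\infty_Y\}+K=\{\pm\infty_Y\}$). $\mathcal L_\Phi=\{T\in\mathcal L(Z,Y):\exists L\in\mathcal L(X,Y),\ \Phi^*(L,T)\neq\{+\infty_Y\}\}$, $\mathcal L_+(S,K)=\{T\in\mathcal L(Z,Y):T(S)\subset K\}$, $\mathcal L_\Phi^+=\mathcal L_\Phi\cap\mathcal L_+(S,K)$. In (ii), continuity at $0_Z$ means: $\Phi(\widehat x,0_Z)\in Y$ and for every neighborhood $V$ of $\Phi(\widehat x,0_Z)$ in $Y$ there is a neighborhood $N$ of $0_Z$ with $\Phi(\widehat x,z)\in V$ for all $z\in N\cap Z_0$. $\operatorname{lin}$, $\operatorname{aff}$ are linear and affine hulls; $\operatorname{ri}U$ is the interior of $U$ relative to $\operatorname{aff}U$; $\operatorname{icr}U=\{z\in Z:\forall z'\in\operatorname{aff}U\ \exists\delta>0,\ z+\lambda z'\in U\ \forall\lambda\in[0,\delta]\}$.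 Complete: every Cauchy net converges. Barreled: every absorbing convex closed subset is a neighborhood of the origin. *)

(* Defs.v *)
From HB Require Import structures.
From mathcomp Require Import all_boot all_order all_algebra.
From mathcomp Require Import all_classical all_reals all_analysis.

Set Implicit Arguments.
Unset Strict Implicit.
Unset Printing Implicit Defensive.

Import Order.TTheory GRing.Theory Num.Theory.
Local Open Scope classical_set_scope.
Local Open Scope ring_scope.

(** Conventions.
    - A locally convex Hausdorff space over the reals is [X : tvsType R] with
      [R : realType], together with [hausdorff_space X].
    - Y^bullet = Y U {-oo, +oo} is the library type [\bar Y], with the library's
      addition and opposite; [-oo + +oo] never occurs below. *)

(** ** Cones, hulls, relative interiors *)

(* Only positive multiples are required, so that 0 need not belong to a cone. *)
Definition convex_cone (R : realType) (V : lmodType R) (C : set V) : Prop :=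
  @convex_set R V C /\ forall (a : R) v, 0 < a -> C v -> C (a *: v).

Definition linear_subspace (R : realType) (V : lmodType R) (A : set V) : Prop :=
  A 0 /\ forall (a : R) u v, A u -> A v -> A (a *: u + v).

Definition affine_subspace (R : realType) (V : lmodType R) (A : set V) : Prop :=
  forall (a : R) u v, A u -> A v -> A (a *: u + (1 - a) *: v).

Definition lin (R : realType) (V : lmodType R) (U : set V) : set V :=
  smallest (@linear_subspace R V) U.

Definition aff (R : realType) (V : lmodType R) (U : set V) : set V :=
  smallest (@affine_subspace R V) U.

Definition finite_dim (R : realType) (V : lmodType R) (A : set V) : Prop :=
  exists2 B : set V, finite_set B & A = lin B.

Definition ri (R : realType) (V : tvsType R) (U : set V) : set V :=
  @interior (subspace (aff U)) U.

Definition icr (R : realType) (V : lmodType R) (U : set V) : set V :=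
  [set z | forall z', aff U z' -> exists2 d : R, 0 < d &
     forall l : R, 0 <= l <= d -> U (z + l *: z')].

(** ** Topological vector spaces *)

Definition directed (I : Type) (le : I -> I -> Prop) : Prop :=
  [/\ inhabited I, forall i, le i i,
      forall i j k, le i j -> le j k -> le i k &
      forall i j, exists2 k, le i k & le j k].

(* The uniform structure bundled in [tvsType] is only required to induce the
   topology; completeness refers to the translation-invariant one, hence the
   Cauchy condition is stated with neighborhoods of 0. *)
Definition tvs_complete (R : realType) (V : tvsType R) : Prop :=
  forall (I : Type) (le : I -> I -> Prop) (x : I -> V), directed le ->
    (forall U : set V, nbhs (0 : V) U ->
       exists i0, forall i j, le i0 i -> le i0 j -> U (x i - x j)) ->
    exists l : V, forall U : set V, nbhs l U ->
      exists i0, forall i, le i0 i -> U (x i).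

Definition first_countable (T : topologicalType) : Prop :=
  forall x : T, exists2 B : set (set T), countable B &
    (forall b, B b -> nbhs x b) /\
    (forall U, nbhs x U -> exists2 b, B b & b `<=` U).

(* The linear subspace A with its induced topology is barreled. *)
Definition barreled (R : realType) (V : tvsType R) (A : set V) : Prop :=
  forall B : set V, B `<=` A ->
    (forall z, A z -> exists2 d : R, 0 < d &
       forall l : R, `|l| <= d -> B (l *: z)) ->
    @convex_set R V B ->
    @closed (subspace A) B ->
    nbhs (0 : subspace A) B.

Record cont_linear (R : realType) (V W : tvsType R) := ContLinear {
  cont_linear_map :> {linear V -> W};
  cont_linear_continuous : continuous (cont_linear_map : V -> W)
}.

(** ** Order and weak supremum in Y^bullet *)

Definition leK (R : realType) (Y : tvsType R) (K : set Y) (u v : \bar Y)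
    : Prop :=
  match u, v with
  | EFin y1, EFin y2 => (-%R @` K) (y1 - y2)
  | ENInf, _ => True
  | _, EPInf => True
  | _, _ => False
  end.

Definition ltK (R : realType) (Y : tvsType R) (K : set Y) (u v : \bar Y)
    : Prop :=
  match u, v with
  | EFin y1, EFin y2 => (-%R @` interior K) (y1 - y2)
  | ENInf, EFin _ => True
  | ENInf, EPInf => True
  | EFin _, EPInf => True
  | _, _ => False
  end.

(* Y^infty = Y U {+oo} *)
Definition Yinfty (R : realType) (Y : tvsType R) : set (\bar Y) :=
  range (@EFin Y) `|` [set +oo%E].

Definition WSup (R : realType) (Y : tvsType R) (K : set Y) (M : set (\bar Y))
    : set (\bar Y) :=
  [set v0 | (forall v, M v -> ~ ltK K v0 v) /\
            (forall v1, ltK K v1 v0 -> exists2 v, M v & ltK K v1 v)].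

(* The Minkowski sum M + K *)
Definition plusK (R : realType) (Y : tvsType R) (M : set (\bar Y)) (K : set Y)
    : set (\bar Y) :=
  [set (v + k%:E)%E | v in M & k in K].

(** ** Perturbation mappings *)

Definition dom (R : realType) (X Y Z : tvsType R) (Phi : X * Z -> \bar Y)
    : set (X * Z) :=
  [set p | Phi p <> +oo%E].

Definition proj_dom (R : realType) (X Y Z : tvsType R)
    (Phi : X * Z -> \bar Y) : set Z :=
  snd @` dom Phi.

Definition proper_map (R : realType) (X Y Z : tvsType R)
    (Phi : X * Z -> \bar Y) : Prop :=
  dom Phi !=set0.

Definition epiK (R : realType) (X Y Z : tvsType R) (K : set Y)
    (Phi : X * Z -> \bar Y) : set (X * Z * Y) :=
  [set p | plusK [set Phi p.1] K (p.2)%:E].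

Definition K_convex (R : realType) (X Y Z : tvsType R) (K : set Y)
    (Phi : X * Z -> \bar Y) : Prop :=
  @convex_set R (X * Z * Y)%type (epiK K Phi).

Definition K_epi_closed (R : realType) (X Y Z : tvsType R) (K : set Y)
    (Phi : X * Z -> \bar Y) : Prop :=
  closed (epiK K Phi).

Definition conjugate (R : realType) (X Y Z : tvsType R) (K : set Y)
    (Phi : X * Z -> \bar Y) (L : cont_linear X Y) (T : cont_linear Z Y)
    : set (\bar Y) :=
  WSup K [set ((L p.1 + T p.2)%R%:E - Phi p)%E | p in setT].

Definition conjugate0 (R : realType) (X Y Z : tvsType R) (K : set Y)
    (Phi : X * Z -> \bar Y) (L : cont_linear X Y) : set (\bar Y) :=
  WSup K [set ((L x)%:E - Phi (x, 0%R))%E | x in setT].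

Definition epi_conjugate0 (R : realType) (X Y Z : tvsType R) (K : set Y)
    (Phi : X * Z -> \bar Y) : set (cont_linear X Y * Y) :=
  [set p | plusK (conjugate0 K Phi p.1) K (p.2)%:E].

Definition epi_conjugate (R : realType) (X Y Z : tvsType R) (K : set Y)
    (Phi : X * Z -> \bar Y) (T : cont_linear Z Y)
    : set (cont_linear X Y * Y) :=
  [set p | plusK (conjugate K Phi p.1 T) K (p.2)%:E].

Definition L_Phi (R : realType) (X Y Z : tvsType R) (K : set Y)
    (Phi : X * Z -> \bar Y) : set (cont_linear Z Y) :=
  [set T | exists L : cont_linear X Y, conjugate K Phi L T <> [set +oo%E]].

Definition L_plus (R : realType) (Y Z : tvsType R) (S : set Z) (K : set Y)
    : set (cont_linear Z Y) :=
  [set T : cont_linear Z Y | T @` S `<=` K].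

Definition L_Phi_plus (R : realType) (X Y Z : tvsType R) (S : set Z)
    (K : set Y) (Phi : X * Z -> \bar Y) : set (cont_linear Z Y) :=
  L_Phi K Phi `&` L_plus S K.

(** ** Qualification conditions *)

Definition cond_i (R : realType) (X Y Z : tvsType R) (K : set Y)
    (Phi : X * Z -> \bar Y) : Prop :=
  exists (x : X) (y : Y) (V : set Z), nbhs (0 : Z) V /\
    forall z, V z -> lin (proj_dom Phi) z -> leK K (Phi (x, z)) y%:E.

Definition cond_ii (R : realType) (X Y Z : tvsType R)
    (Phi : X * Z -> \bar Y) : Prop :=
  exists (x : X) (y : Y), Phi (x, 0) = y%:E /\
    forall V : set Y, nbhs y V ->
      exists2 N : set Z, nbhs (0 : Z) N &
        forall z, N z -> lin (proj_dom Phi) z ->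
          exists2 v, V v & Phi (x, z) = v%:E.

Definition cond_iii (R : realType) (X Y Z : tvsType R)
    (Phi : X * Z -> \bar Y) : Prop :=
  finite_dim (lin (proj_dom Phi)) /\ ri (proj_dom Phi) 0.

Definition cond_iv (R : realType) (X Y Z : tvsType R) (K : set Y)
    (Phi : X * Z -> \bar Y) : Prop :=
  [/\ tvs_complete X /\ first_countable X,
      tvs_complete Y /\ first_countable Y,
      barreled (lin (proj_dom Phi)),
      K_epi_closed K Phi &
      icr (proj_dom Phi) 0].

Definition cond_v (R : realType) (X Y Z : tvsType R) (K : set Y)
    (Phi : X * Z -> \bar Y) : Prop :=
  (forall x z, dom Phi (x, z) -> leK K (Phi (x, 0)) (Phi (x, z))) /\
  interior (proj_dom Phi) !=set0.

(* Main.v *)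
Require Import Defs.
From HB Require Import structures.
From mathcomp Require Import all_boot all_order all_algebra.
From mathcomp Require Import ring lra.
From mathcomp Require Import all_classical all_reals all_analysis.

Set Implicit Arguments.
Unset Strict Implicit.
Unset Printing Implicit Defensive.

Import Order.TTheory GRing.Theory Num.Theory.
Local Open Scope classical_set_scope.
Local Open Scope ring_scope.

(** The key fact is that [y] lies in [WSup M + K] iff no [v] in [M] satisfies
    [y <_K v], because a maximal translate [y - t e], with [e] interior to [K], is
    a weak supremum. Hence [(L, y)] is in the epigraph of the conjugate of
    [Phi (., 0)] iff the convex set [D] of all [(z, w)] with
    [w >=_K Phi (x, z) - L x + y] for some [x] misses [{0} * - int K], and [T]
    certifies it iff [L x + T z - Phi (x, z) - y] is never interior to [K].
    Separating algebraically yields a linear form [zs z + ys w], nonnegative on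
    [D], with [ys] nonnegative on [K] and [ys e = 1]; then [T z = - zs z *: e]
    works, provided [zs] has a continuous extension from [Z_0] to [Z]. Under
    (i), (ii) and (iv) it has one by Hahn-Banach, since [D] contains [(z, w0)]
    for a fixed [w0] and all [z] near 0 in [Z_0]; for (iv) this is Ursescu's
    theorem. Under (iii) every linear form on [Z_0] is continuous, and under
    (v) [T = 0] works. Finally [T] is positive on [S], as [zs] is bounded above
    on the rays spanned by [S]. *)

(* A reflexive decision procedure for identities between linear combinations:
   [lmod_eq] compares coefficients atom by atom with [field]. *)
Inductive lexp (R : Type) : Type :=
  LVar of nat | LZero | LAdd of lexp R & lexp R | LOpp of lexp R
  | LScale of R & lexp R.
Arguments LVar {R}.
Arguments LZero {R}.

Section lexp.
Variables (R : realType) (V : lmodType R) (env : seq V).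

Fixpoint leval (e : lexp R) : V :=
  match e with
  | LVar n => env`_n
  | LZero => 0
  | LAdd e1 e2 => leval e1 + leval e2
  | LOpp e1 => - leval e1
  | LScale a e1 => a *: leval e1
  end.

Fixpoint lcoef (e : lexp R) (i : nat) : R :=
  match e with
  | LVar n => if n == i then 1 else 0
  | LZero => 0
  | LAdd e1 e2 => lcoef e1 i + lcoef e2 i
  | LOpp e1 => - lcoef e1 i
  | LScale a e1 => a * lcoef e1 i
  end.

(** Computed by recursion on the number of atoms, so that simplification leaves one scalar identity
    per atom. *)
Fixpoint lagree (e1 e2 : lexp R) (n : nat) : Prop :=
  if n is n'.+1 then lcoef e1 n' = lcoef e2 n' /\ lagree e1 e2 n' else True.

Lemma lexpP (e1 e2 : lexp R) :
  lagree e1 e2 (size env) -> leval e1 = leval e2.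
Proof.
have levalE (e : lexp R) : leval e = \sum_(i < size env) lcoef e i *: env`_i.
  elim: e => /= [n||f -> g ->|f ->|a f ->].
  - have [nlt|nge] := ltnP n (size env).
      rewrite (bigD1 (Ordinal nlt))//= eqxx scale1r big1 ?addr0// => i ni.
      by rewrite ifN ?scale0r// eq_sym.
    (* An index out of range evaluates to the default value 0, and its coefficient vanishes at every
       index below [size env]. *)
    rewrite nth_default// big1// => i _; rewrite ifN ?scale0r//.
    by rewrite gtn_eqF// (leq_trans _ nge).
  - by rewrite big1// => i _; rewrite scale0r.
  - by rewrite -big_split; apply: eq_bigr => i _; rewrite scalerDl.
  - by rewrite -sumrN; apply: eq_bigr => i _; rewrite scaleNr.
  - by rewrite scaler_sumr; apply: eq_bigr => i _; rewrite scalerA.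
have agree n i : (i < n)%N -> lagree e1 e2 n -> lcoef e1 i = lcoef e2 i.
  elim: n => // n IH; rewrite ltnS leq_eqVlt => /predU1P[->|/IH e12] [en] //.
by move=> e12; rewrite !levalE; apply: eq_bigr => i _; rewrite (agree _ _ _ e12).
Qed.

End lexp.

Ltac lmod_atoms acc t :=
  lazymatch t with
  | (?a + ?b)%R => let acc1 := lmod_atoms acc a in lmod_atoms acc1 b
  | (- ?a)%R => lmod_atoms acc a
  | (_ *: ?a)%R => lmod_atoms acc a
  | 0%R => acc
  | ?x => lazymatch acc with
          | context [x :: _] => acc
          | _ => constr:(x :: acc)
          end
  end.
Ltac lmod_index x l :=
  lazymatch l with
  | x :: _ => constr:(0%N)
  | _ :: ?l' => let n := lmod_index x l' in constr:(n.+1)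
  end.
Ltac lmod_quote l t :=
  lazymatch t with
  | (?a + ?b)%R =>
      let a' := lmod_quote l a in let b' := lmod_quote l b in
      open_constr:(LAdd a' b')
  | (- ?a)%R => let a' := lmod_quote l a in open_constr:(LOpp a')
  | (?c *: ?a)%R => let a' := lmod_quote l a in open_constr:(LScale c a')
  | 0%R => open_constr:(LZero)
  | ?x => let n := lmod_index x l in open_constr:(LVar n)
  end.
Ltac lmod_eq :=
  lazymatch goal with
  | |- @eq ?V ?u ?v =>
      let l0 := lmod_atoms constr:(@nil V) u in
      let l := lmod_atoms l0 v in
      let u' := lmod_quote l u in
      let v' := lmod_quote l v in
      apply: (@lexpP _ _ l u' v'); rewrite /=; repeat split;
      (try by []); (try by ring); try by field
  end.

(** * Separation of convex sets *)

Lemma convex_setP (R : realType) (V : lmodType R) (A : set V) :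
  @convex_set R V A <-> forall (t : R) u v, 0 <= t <= 1 -> A u -> A v ->
    A (t *: u + (1 - t) *: v).
Proof.
split=> [cA t u v t01 Au Av|cA u v l /set_mem Au /set_mem Av].
- have tb : Itv.spec (Itv.num_sem (R:=R)) (Itv.Real `[0%Z, 1%Z]) t.
    rewrite /= /Itv.num_sem /= num_real /=.
    by rewrite in_itv /=.
  have := cA u v (Itv.mk tb) (mem_set Au) (mem_set Av).
  by move/set_mem.
- by apply/mem_set/cA => //; rewrite ge0 le1.
Qed.

Section linear_subspace.
Variables (R : realType) (V : lmodType R) (A : set V).
Hypothesis linA : linear_subspace A.

Lemma linear_subspaceD u v : A u -> A v -> A (u + v).
Proof. by move=> Au Av; rewrite -[u]scale1r; apply linA.2. Qed.

Lemma linear_subspaceZ (a : R) u : A u -> A (a *: u).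
Proof. by move=> Au; rewrite -[_ *: _]addr0; apply linA.2 => //; exact: linA.1. Qed.

Lemma linear_subspaceN u : A u -> A (- u).
Proof. by move=> Au; rewrite -scaleN1r; exact: linear_subspaceZ. Qed.

Lemma linear_subspaceB u v : A u -> A v -> A (u - v).
Proof. by move=> Au Av; apply: linear_subspaceD => //; exact: linear_subspaceN. Qed.

End linear_subspace.

Lemma lin_linear (R : realType) (V : lmodType R) (U : set V) :
  linear_subspace (lin U).
Proof.
split=> [A [[A0 _] _] //|a u v Uu Uv A [lA UA]].
by apply: lA.2; [exact: Uu|exact: Uv].
Qed.

(* M. Riesz extension, with linear forms represented by their graphs. It serves
   with the cone spanned by a convex set, then with [C = {0}] to reach the points
   of [V] outside of the subspace where that cone has a core; in both cases the
   lower and the upper bounds on the value at [v] exist or fail together. *)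
Lemma riesz_extension (R : realType) (V : lmodType R) (C : set V)
    (G0 : set (V * R^o)) :
  (forall (t : R) v, 0 < t -> C v -> C (t *: v)) ->
  (forall u v, C u -> C v -> C (u + v)) ->
  linear_subspace G0 -> (forall p, G0 p -> C p.1 -> 0 <= p.2) ->
  exists G : set (V * R^o), [/\ linear_subspace G, G0 `<=` G,
    (forall p, G p -> C p.1 -> 0 <= p.2) &
    forall v, ((exists2 p, G p & C (p.1 + v)) <->
               (exists2 p, G p & C (p.1 - v))) -> exists s, G (v, s)].
Proof.
move=> CZ CD lG0 G0pos.
pose good (G : set (V * R^o)) :=
  linear_subspace G /\ forall p, G p -> C p.1 -> 0 <= p.2.
(* Zorn's lemma runs over the sets whose union with [G0] is good, so that the empty chain, with
   empty union, falls back on [G0]. *)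
have [|G [[lG Gpos] Gmax]] :=
    @Zorn_bigcup (V * R^o)%type [set G | good (G0 `|` G)].
  move=> F Fgood Ftot.
  have [F0|/set0P[H0 FH0]] := eqVneq F set0.
    by rewrite /= F0 bigcup_set0 setU0; split.
  have cup p : (G0 `|` \bigcup_(X in F) X) p -> exists2 X, F X & (G0 `|` X) p.
    move=> [G0p|[X FX Xp]]; first by exists H0 => //; left.
    by exists X => //; right.
  split=> [|p /cup[X /Fgood[_]]]; last exact.
  split=> [|a u v /cup[X FX Xu] /cup[Y FY Yv]]; first by left; exact: lG0.1.
  have [Z FZ [Zu Zv]] : exists2 Z, F Z & (G0 `|` Z) u /\ (G0 `|` Z) v.
    have [XY|YX] := Ftot _ _ FX FY.
      by exists Y => //; split=> //; exact: setUS Xu.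
    by exists X => //; split=> //; exact: setUS Yv.
  have [[_ lZ] _] := Fgood _ FZ.
  by case: (lZ a u v Zu Zv) => [|Zuv]; [left|right; exists Z].
exists (G0 `|` G); split=> // v sym.
apply: contrapT => Gv.
(* Positivity on [C] bounds the value at [v] below by the elements of [A] and above by the [p.2]
   with [C (p.1 - v)]. If there are no bounds, [A] is empty and its default supremum serves. *)
pose A : set R := [set - p.2 | p in [set p | (G0 `|` G) p /\ C (p.1 + v)]].
pose s : R := sup A.
have ubA p : (G0 `|` G) p -> C (p.1 - v) -> ubound A p.2.
  move=> Gp Cp _ [q [Gq Cq] <-]; rewrite lerNl -subr_ge0 opprK addrC.
  have := Gpos _ (linear_subspaceD lG Gp Gq); apply.
  by have := CD _ _ Cp Cq; rewrite addrACA addNr addr0.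
have leA p : (G0 `|` G) p -> C (p.1 + v) -> - p.2 <= s.
  move=> Gp Cp; apply: sup_ubound; last by exists p.
  have [[q Gq Cq] _] := (sym.1 (ex_intro2 _ _ p Gp Cp), tt).
  by exists q.2; exact: ubA.
have geA p : (G0 `|` G) p -> C (p.1 - v) -> s <= p.2.
  move=> Gp Cp; apply: sup_le_ub; last exact: ubA.
  have [q Gq Cq] := sym.2 (ex_intro2 _ _ p Gp Cp).
  by exists (- q.2), q.
pose G' : set (V * R^o) := [set p | exists q (t : R),
  (G0 `|` G) q /\ p = q + t *: ((v, s) : V * R^o)].
have subG' : G0 `|` G `<=` G'.
  by move=> p Gp; exists p, 0; rewrite scale0r addr0.
have G'vs : G' (v, s) by exists 0, 1; rewrite scale1r add0r; split=> //; apply lG.1.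
apply: (Gmax G').
  split; first by move=> p Gp; apply: subG'; right.
  by move=> G'G; apply: Gv; exists s; right; exact: G'G.
rewrite /=; have -> : G0 `|` G' = G'.
  by apply/setUidPr; apply: subset_trans subG'; exact: subsetUl.
split.
  split; first by apply: subG'; apply lG.1.
  move=> a _ _ [p [t [Gp ->]]] [q [t' [Gq ->]]].
  exists (a *: p + q), (a * t + t'); split; first exact: lG.2.
  by rewrite scalerDr scalerA scalerDl addrACA.
move=> _ [q [t [Gq ->]]] /= Cq.
(* Dividing by the absolute value of [t] leads to a vector [p.1 - v] or [p.1 + v] of [C], where
   [geA] or [leA] applies. *)
have [t0|t0|t0] := ltgtP t 0.
- have t'0 : 0 < (- t)^-1 by rewrite invr_gt0 oppr_gt0.
  have /geA : (G0 `|` G) ((- t)^-1 *: q) by exact: linear_subspaceZ.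
  have := CZ _ _ t'0 Cq; rewrite scalerDr scalerA invrN mulNr mulVf ?lt_eqF//.
  rewrite scaleN1r => /[swap] /[apply] /=.
  rewrite -(ler_pM2l (_ : 0 < - t)) ?oppr_gt0// => h.
  rewrite -lerBlDr add0r -mulNr (le_trans h)//.
  by rewrite /GRing.scale/= mulrA mulrNN mulfV ?mul1r// lt_eqF.
- have t'0 : 0 < t^-1 by rewrite invr_gt0.
  have /leA : (G0 `|` G) (t^-1 *: q) by exact: linear_subspaceZ.
  have := CZ _ _ t'0 Cq; rewrite scalerDr scalerA mulVf ?gt_eqF//.
  rewrite scale1r => /[swap] /[apply] /=.
  rewrite -(ler_pM2l t0) => h.
  rewrite -lerBlDl add0r (le_trans _ h)//.
  by rewrite mulrN /GRing.scale/= mulrA mulfV ?mul1r// gt_eqF.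
- move: Cq; rewrite t0 scale0r addr0 => /(Gpos _ Gq).
  by rewrite /GRing.scale/= mul0r addr0.
Qed.
Lemma ratio_itv01 (R : realType) (s t : R) : 0 < s -> 0 <= t ->
  0 <= s / (s + t) <= 1.
Proof.
move=> s0 t0; have st0 : 0 < s + t by rewrite ltr_wpDr.
by rewrite ler_pdivrMr// mul1r lerDl t0 andbT divr_ge0// ltW.
Qed.

(** Nonnegativity over 0, applied to both differences of two values over the same point, makes [G]
    single-valued. *)
Lemma linear_graph (R : realType) (V : lmodType R) (G : set (V * R^o)) :
  linear_subspace G -> (forall r, G (0, r) -> 0 <= r) ->
  (forall v, exists r, G (v, r)) ->
  exists f : {linear V -> R^o}, forall v r, G (v, r) -> f v = r.
Proof.
move=> lG G0 Gtot.
have Gfun v r s : G (v, r) -> G (v, s) -> r = s.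
  move=> Gr Gs; apply/eqP; rewrite eq_le -subr_ge0 -[_ <= r]subr_ge0.
  by rewrite !G0// -(subrr v); [exact: (linear_subspaceB lG Gr Gs)
    |exact: (linear_subspaceB lG Gs Gr)].
pose f v : R^o := projT1 (cid (Gtot v)).
have Gf v : G (v, f v) by exact: projT2 (cid (Gtot v)).
have flin : linear f.
  by move=> a u v; apply: Gfun (Gf _) _; apply: (lG.2 a (u, f u) (v, f v)).
pose fL := GRing.isLinear.Build _ _ _ _ f flin.
pose F : {linear V -> R^o} := HB.pack f fL.
by exists F => v r; exact: Gfun.
Qed.

(** The form sending [t *: p0] to [t] is nonnegative on the cone [C] spanned by [A], because 0 is
    not in [A]. As [p0] is in the core of [A] relative to [W], a first Riesz extension reaches [W];
    a second one reaches [V]. *)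
Lemma separation (R : realType) (V : lmodType R) (W A : set V) (p0 : V) :
  linear_subspace W -> @convex_set R V A -> A `<=` W -> ~ A 0 -> W p0 ->
  (forall v, W v -> exists2 d : R, 0 < d & A (p0 + d *: v)) ->
  exists f : {linear V -> R^o}, f p0 = 1 /\ forall a, A a -> 0 <= f a.
Proof.
move=> lW /convex_setP cA AW A0 Wp0 core.
pose C := [set v | v = 0 \/ exists (t : R) a, [/\ 0 < t, A a & v = t *: a]].
have AC a : A a -> C a by right; exists 1, a; rewrite scale1r.
have CZ (t : R) v : 0 < t -> C v -> C (t *: v).
  move=> t0 [->|[s [a [s0 Aa ->]]]]; first by left; rewrite scaler0.
  by right; exists (t * s), a; rewrite scalerA mulr_gt0.
have CD u v : C u -> C v -> C (u + v).
  move=> [->|[s [a [s0 Aa ->]]]]; first by rewrite add0r.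
  move=> [->|[t [b [t0 Ab ->]]]].
    by rewrite addr0; right; exists s, a.
  have st0 : 0 < s + t by exact: addr_gt0.
  right; exists (s + t), ((s / (s + t)) *: a + (1 - s / (s + t)) *: b); split=> //.
    by apply: cA => //; apply: ratio_itv01 => //; exact: ltW.
  rewrite scalerDr !scalerA mulrBr mulr1 mulrCA mulfV ?gt_eqF// mulr1.
  by rewrite addrAC subrr add0r.
have Ap0 : A p0.
  by have [d _] := core _ lW.1; rewrite scaler0 addr0.
pose G0 : set (V * R^o) := [set p | p.1 = (p.2 : R) *: p0].
have lG0 : linear_subspace G0.
  split; first by rewrite /G0/= scale0r.
  by move=> a [u r] [v s]; rewrite /G0/= => -> ->; rewrite scalerA -scalerDl.
have G0pos p : G0 p -> C p.1 -> 0 <= p.2.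
  (* If [t *: p0 = s *: a] with [t < 0], then 0 is the convex combination of [a] and [p0] with
     weights [s / (s - t)] and [- t / (s - t)]. *)
  case: p => v t; rewrite /G0/= => -> Ctp; rewrite leNgt; apply/negP => t0.
  have [/(congr1 ( *:%R t^-1))|[s [a [s0 Aa]]]] := Ctp.
    rewrite scalerA mulVf ?lt_eqF// scale1r scaler0 => p00.
    by apply: A0; rewrite -p00.
  move=> tpsa; have st0 : 0 < s - t by rewrite subr_gt0 (lt_trans t0).
  apply: A0.
  suff <- : (s / (s - t)) *: a + (1 - s / (s - t)) *: p0 = 0.
    by apply: cA => //; apply: ratio_itv01; rewrite // oppr_ge0 ltW.
  have st : s - t != 0 by rewrite gt_eqF.
  apply: (scalerI st); rewrite scaler0.
  rewrite scalerDr !scalerA mulrBr mulr1 mulrCA mulfV// mulr1.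
  by rewrite -tpsa -scalerDl addrAC subrr add0r subrr scale0r.
have [G1 [lG1 G01 G1pos ext1]] := riesz_extension CZ CD lG0 G0pos.
have domG1 v : W v -> exists s, G1 (v, s).
  (* Taken at [v] and at [- v], this gives the lower and the upper bounds required by the
     extension. *)
  have half u : W u -> exists2 p, G1 p & C (p.1 + u).
    move=> /core[d d0 Ad]; exists (d^-1 *: p0, d^-1 : R^o); first exact: G01.
    right; exists d^-1, (p0 + d *: u); rewrite invr_gt0; split=> //.
    by rewrite scalerDr scalerA mulVf ?gt_eqF// scale1r.
  by move=> Wv; apply: ext1; split=> _; apply: half => //; exact: linear_subspaceN.
(* For the cone reduced to 0, changing the sign of [p] exchanges the two kinds of bounds, so every
   [v] is reached. *)
have [||||G2 [lG2 G12 G2pos ext2]] := @riesz_extension R V [set 0] G1.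
- by move=> t _ _ ->; rewrite /= scaler0.
- by move=> _ _ -> ->; rewrite /= addr0.
- by [].
- by move=> p G1p p0E; apply: G1pos => //; left.
have G2sym v p : G2 p -> p.1 + v = 0 -> exists2 p, G2 p & p.1 - v = 0.
  move=> G2p pv; exists (- p); first exact: linear_subspaceN.
  by rewrite /= -opprD pv oppr0.
have [|v|f fG2] := linear_graph lG2.
- by move=> r G2r; exact: (G2pos _ G2r).
- by apply: ext2; split=> -[p Gp pv]; [exact: G2sym Gp pv|];
    rewrite -[v]opprK; exact: G2sym Gp pv.
exists f; split=> [|a Aa].
  by apply/fG2/G12/G01; rewrite /G0/= scale1r.
have [s G1s] := domG1 _ (AW _ Aa).
by rewrite (fG2 _ _ (G12 _ G1s)); apply: G1pos G1s _ => /=; exact: AC.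
Qed.

(** * Continuous linear forms *)

Section tvs_neighborhoods.
Variables (R : realType) (E : tvsType R).
Implicit Types U : set E.

Lemma nbhs0_convex U : nbhs 0 U ->
  exists2 V : set E, nbhs 0 V & @convex_set R E V /\ V `<=` U.
Proof.
move=> U0; have [B cB [oB bB]] := @locally_convex R E.
have [V [BV V0] VU] := bB 0 U U0.
exists V; first by apply: open_nbhs_nbhs; split=> //; exact: oB.
by split=> //; exact: cB (mem_set BV).
Qed.

Lemma nbhs_scale_left U (x : E) : nbhs 0 U ->
  exists2 d : R, 0 < d & forall l : R, `|l| <= d -> U (l *: x).
Proof.
move=> U0; have := @scale_continuous R E (0, x) U.
rewrite /= scale0r => /(_ U0)[[A B] /= [A0 Bx] ABU].
have /nbhs_ballP[d /= d0 dA] := A0.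
exists (d / 2) => [|l ld]; first by rewrite divr_gt0.
apply: (ABU (l, x)); split=> /=; last exact: nbhs_singleton.
apply: dA; rewrite /ball/= sub0r normrN (le_lt_trans ld)//.
by rewrite ltr_pdivrMr// ltr_pMr// ltr1n.
Qed.

Lemma nbhs0_scale U (r : R) : r != 0 -> nbhs 0 U ->
  nbhs 0 [set z : E | U (r *: z)].
Proof.
move=> r0 /(nbhs0Z (_ : r^-1 != 0)); rewrite invr_eq0 => /(_ r0).
apply: filterS => _ [u Uu <-] /=.
by rewrite scalerA mulfV// scale1r.
Qed.

Lemma nbhs0_opp U : nbhs 0 U -> nbhs 0 [set z : E | U (- z)].
Proof.
by move=> /nbhs0N; apply: filterS => _ [u Uu <-] /=; rewrite opprK.
Qed.

Lemma nbhs_translate U (x : E) : nbhs x U <-> nbhs 0 [set z | U (x + z)].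
Proof.
split=> [/(nbhsB (- x))|/(nbhsT x)].
  by rewrite addNr; apply: filterS => _ [u Uu <-] /=; rewrite addNKr.
by apply: filterS => _ [u Uu <-].
Qed.

Lemma translate_continuous (a : E) : continuous (fun z : E => a + z).
Proof.
move=> z W /nbhs_translate W0; apply/nbhs_translate.
by apply: filterS W0 => u /=; rewrite addrA.
Qed.

Lemma nbhs0_half U : nbhs 0 U ->
  exists2 V : set E, nbhs 0 V & forall u v, V u -> V v -> U (u + v).
Proof.
move=> U0; have := @add_continuous E (0, 0) U.
rewrite /= addr0 => /(_ U0)[[A B] /= [A0 B0] ABU].
exists (A `&` B); first exact: filterI.
by move=> u v [Au _] [_ Bv]; exact: (ABU (u, v)).
Qed.

End tvs_neighborhoods.

(** On the intersection of [U] with its opposite, the lower bound becomes a bound on the absolute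
    value, which scaling makes arbitrarily small. *)
Lemma linear_form_continuous (R : realType) (Z : tvsType R)
    (f : {linear Z -> R^o}) (U : set Z) (c : R) :
  nbhs 0 U -> (forall z, U z -> - c <= f z) -> continuous (f : Z -> R^o).
Proof.
move=> U0 fU x; apply/cvgrPdist_lt => e e0.
have c0 : 0 < `|c| + 1 by rewrite ltr_wpDl.
have key (a : R) : - c <= a -> - c <= - a -> `|a| <= `|c|.
  by rewrite lerN2 lerNl => ca ac; rewrite (le_trans _ (ler_norm c))// ler_norml lerNl ca.
(* The added 1 avoids a division by 0 and makes the final inequality strict. *)
pose s := e / (`|c| + 1).
have s0 : 0 < s by rewrite divr_gt0.
have UN : nbhs 0 (U `&` [set z | U (- z)]) by apply: filterI => //; exact: nbhs0_opp.
have s'0 : s^-1 != 0 by rewrite invr_eq0 gt_eqF.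
have sU := nbhs0_scale s'0 UN.
apply/nbhs_translate; apply: filterS sU => z /= [/fU fz1].
move=> /fU; rewrite linearN => fz2.
rewrite linearD opprD addrA subrr sub0r normrN.
have -> : f z = s * f (s^-1 *: z).
  by rewrite linearZ/= /GRing.scale/= mulrA mulfV ?mul1r// gt_eqF.
rewrite normrM (gtr0_norm s0) -ltr_pdivlMl//.
have -> : s^-1 * e = `|c| + 1 by rewrite /s invf_div mulrVK// unitfE gt_eqF.
rewrite (@le_lt_trans _ _ `|c|)//; last by rewrite ltrDl.
exact: key.
Qed.

(** Separate 0 from the sum [A] of the affine hyperplane [g = 1] of [Z0] and a convex neighborhood
    [V] of 0. The resulting [f] is at least -1 on [V], hence continuous; it is nonnegative on the
    hyperplane, hence zero on the kernel of [g] in [Z0], and [f z1 = 1] fixes the factor. *)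
Lemma hahn_banach_extension (R : realType) (Z : tvsType R) (Z0 U : set Z)
    (g : {linear Z -> R^o}) (c : R) :
  linear_subspace Z0 -> nbhs 0 U ->
  (forall z, U z -> Z0 z -> - c <= g z) ->
  exists f : {linear Z -> R^o},
    continuous (f : Z -> R^o) /\ forall z, Z0 z -> f z = g z.
Proof.
move=> lZ0 U0 gU.
have [[z [Z0z gz]]|gZ0] := pselect (exists z, Z0 z /\ g z <> 0); last first.
  exists (\0 : {linear Z -> R^o}); split=> [|z Z0z]; first exact: cst_continuous.
  apply: contrapT => gz; apply: gZ0; exists z; split=> // gz0.
  by apply: gz; rewrite gz0.
have [z1 [Z0z1 gz1]] : exists z1, Z0 z1 /\ g z1 = 1.
  exists ((g z)^-1 *: z); split; first exact: linear_subspaceZ.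
  by rewrite linearZ/= /GRing.scale/= mulVf//; exact/eqP.
have c0 : 0 < `|c| + 1 by rewrite ltr_wpDl.
(* Shrinking by [|c| + 1] ensures [g > -1] on the part of [V] in [Z0], which keeps 0 out of [A]. *)
have := nbhs0_scale (lt0r_neq0 c0) U0.
move=> /nbhs0_convex[V V0 [/convex_setP cV VU]].
have gV v : V v -> Z0 v -> -1 < g v.
  move=> /VU/= Uv Z0v; have := gU _ Uv (linear_subspaceZ lZ0 _ Z0v).
  rewrite linearZ/= /GRing.scale/= => h.
  rewrite -(ltr_pM2l c0) (lt_le_trans _ h)// mulrN1 ltrN2.
  by rewrite (le_lt_trans (ler_norm c))// ltrDl.
pose A := [set a | exists z v, [/\ Z0 z, g z = 1, V v & a = z + v]].
have [||||||f [fz1 fA]] := @separation R Z setT A z1.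
- by split.
- apply/convex_setP => t _ _ t01 [x [v [Zx gx Vv ->]]] [y [w [Zy gy Vw ->]]].
  exists (t *: x + (1 - t) *: y), (t *: v + (1 - t) *: w); split.
  + by apply: lZ0.2 => //; exact: linear_subspaceZ.
  + by rewrite linearD !linearZ/= gx gy /GRing.scale/= !mulr1 addrC subrK.
  + exact: cV.
  + by rewrite !scalerDr addrACA.
- by [].
- move=> [x [v [Zx gx Vv /esym/eqP]]]; rewrite addr_eq0 => /eqP xv.
  have := gV v Vv; rewrite -[v]opprK -xv linearN gx ltxx.
  by move=> h; suff: false by []; apply: h; exact: linear_subspaceN.
- by [].
- move=> v _; have [d d0 dV] := nbhs_scale_left v V0.
  exists d => //; exists z1, (d *: v); split=> //.
  by apply: dV; rewrite gtr0_norm.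
have f1 x : Z0 x -> g x = 1 -> 0 <= f x.
  move=> Zx gx; apply: fA; exists x, 0; rewrite addr0; split=> //.
  exact: nbhs_singleton.
exists f; split.
  apply: (@linear_form_continuous _ _ f V 1) => // v Vv.
  rewrite -subr_ge0 opprK addrC -fz1 -linearD; apply: fA.
  by exists z1, v.
move=> x Z0x.
have fg0 w : Z0 w -> g w = 0 -> 0 <= f w.
  move=> Zw gw; rewrite leNgt; apply/negP => fw.
  (* The coefficient is chosen to give [f] the value [1 - 2] at a point of the hyperplane. *)
  have : 0 <= f (z1 + (- 2 / f w) *: w).
    apply: f1; first by apply: linear_subspaceD => //; exact: linear_subspaceZ.
    by rewrite linearD linearZ/= gw scaler0 addr0.
  rewrite linearD linearZ/= fz1 /GRing.scale/= mulrVK ?unitfE ?lt_eqF//.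
  by rewrite leNgt; lra.
pose w := x - g x *: z1.
have Zw : Z0 w by apply: linear_subspaceB => //; exact: linear_subspaceZ.
have gw : g w = 0.
  by rewrite linearB linearZ/= gz1 /GRing.scale/= mulr1 subrr.
have : f w = 0.
  apply/eqP; rewrite eq_le fg0// andbT -oppr_ge0 -linearN fg0//.
    exact: linear_subspaceN.
  by rewrite linearN gw oppr0.
by rewrite linearB linearZ/= fz1 /GRing.scale/= mulr1 => /eqP; rewrite subr_eq0 => /eqP.
Qed.

(** Separate 0 from [c + V], where the convex neighborhood [V] of 0 avoids [- c]. *)
Lemma hahn_banach_point (R : realType) (Z : tvsType R) (c : Z) :
  hausdorff_space Z -> c != 0 ->
  exists f : {linear Z -> R^o}, continuous (f : Z -> R^o) /\ f c = 1.
Proof.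
move=> hZ c0.
have : nbhs 0 (~` [set - c]).
  apply: open_nbhs_nbhs; split; last by move=> /esym/eqP; rewrite oppr_eq0 (negbTE c0).
  by apply: closed_openC; apply: accessible_closed_set1; exact: hausdorff_accessible.
move=> /nbhs0_convex[V V0 [/convex_setP cV VU]].
have [||||||f [fc fA]] := @separation R Z setT [set c + v | v in V] c.
- by split.
- apply/convex_setP => t _ _ t01 [v Vv <-] [w Vw <-].
  exists (t *: v + (1 - t) *: w); first exact: cV.
  by rewrite !scalerDr addrACA -scalerDl addrC (addrC t) subrK scale1r addrC.
- by [].
- move=> [v Vv /eqP]; rewrite addrC addr_eq0 => /eqP vc.
  exact: (VU v).
- by [].
- move=> v _; have [d d0 dV] := nbhs_scale_left v V0.
  by exists d => //; exists (d *: v) => //; apply: dV; rewrite gtr0_norm.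
exists f; split=> //; apply: (@linear_form_continuous _ _ f V 1) => // v Vv.
by rewrite -subr_ge0 opprK addrC -fc -linearD; apply: fA; exists v.
Qed.

(* [P] projects onto the span of [s]; continuity is only asked after composition
   with linear forms, so that all linear forms on the span are dealt with. *)
Lemma finite_continuous_projection (R : realType) (Z : tvsType R) (s : seq Z) :
  hausdorff_space Z ->
  exists P : {linear Z -> Z}, (forall b, b \in s -> P b = b) /\
    forall g : {linear Z -> R^o}, continuous (fun z => g (P z) : R^o).
Proof.
move=> hZ; elim: s => [|b s [P [Pid Pcont]]].
  exists (\0 : {linear Z -> Z}); split=> // g.
  by rewrite [X in continuous X](_ : _ = cst (g 0)); [exact: cst_continuous|].
have [Pbb|Pbb] := eqVneq (P b) b.
  by exists P; split=> // x; rewrite inE => /predU1P[->//|/Pid].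
pose c := b - P b.
have c0 : c != 0 by rewrite subr_eq0 eq_sym.
have [f [fcont fc]] := hahn_banach_point hZ c0.
(* A rank-one correction: [Q] fixes [b] because [f c = 1], and still fixes the fixed points of
   [P]. *)
pose Q z := P z + f (z - P z) *: c.
have Qlin : linear Q.
  move=> a u v; rewrite /Q.
  have -> : a *: u + v - P (a *: u + v) = a *: (u - P u) + (v - P v).
    by rewrite linearP opprD addrACA scalerBr.
  by rewrite linearP [f _]linearP scalerDl addrACA [in RHS]scalerDr [in RHS]scalerA.
pose QL := GRing.isLinear.Build _ _ _ _ Q Qlin.
pose QQ : {linear Z -> Z} := HB.pack Q QL.
exists QQ; split=> [x|g].
  rewrite inE /QQ/= /Q => /predU1P[->|/Pid ->]; first by rewrite fc scale1r addrC subrK.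
  by rewrite subrr linear0 scale0r addr0.
rewrite [X in continuous X](_ : _ =
    (fun z => g (P z) + (f z - f (P z)) * g c : R^o)); last first.
  by apply/funext => z; rewrite /QQ/= /Q [g _]linearD [g (_ *: _)]linearZ/= linearB.
(* The induction hypothesis is used both for [g] and for [f]. *)
move=> z; apply: cvgD; first exact: Pcont.
by apply: cvgMl; apply: cvgB; [exact: fcont|exact: Pcont].
Qed.

Lemma finite_dim_continuous (R : realType) (Z : tvsType R) (B : set Z)
    (g : {linear Z -> R^o}) :
  hausdorff_space Z -> finite_set B ->
  exists f : {linear Z -> R^o},
    continuous (f : Z -> R^o) /\ forall z, lin B z -> f z = g z.
Proof.
move=> hZ /finite_seqP[s ->].
have [P [Pid Pcont]] := finite_continuous_projection s hZ.
exists (g \o P : {linear Z -> R^o}); split=> [|z]; first exact: Pcont.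
apply: (@smallest_sub _ _ _ [set z | (g \o P) z = g z]); last first.
  by move=> b bs /=; rewrite Pid.
split=> [|a u v /= gu gv]; first by rewrite /= !linear0.
by rewrite !linearP/= gu gv.
Qed.

(** * Cones and weak suprema *)

Section cone.
Variables (R : realType) (Y : tvsType R) (K : set Y).
Hypotheses (K_cone : convex_cone K) (K_closed : closed K).

Lemma coneD u v : K u -> K v -> K (u + v).
Proof.
have [/convex_setP cK KZ] := K_cone => Ku Kv.
have -> : u + v = 2 *: ((2^-1 : R) *: u + (1 - 2^-1) *: v).
  by rewrite scalerDr !scalerA mulfV// mulrBr mulr1 mulfV// !scale1r addrK scale1r.
by apply: KZ => //; apply: cK => //; lra.
Qed.

(** The definition of a cone does not include 0; here 0 is the limit of the small positive multiples
    of [k]. *)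
Lemma cone0 : K !=set0 -> K 0.
Proof.
move=> [k Kk]; apply: contrapT => K0.
have : nbhs 0 (~` K) by apply: open_nbhs_nbhs; split=> //; exact: closed_openC.
move=> /(nbhs_scale_left k)[d d0 /(_ d)]; rewrite gtr0_norm// => /(_ (lexx _)).
by apply; exact: K_cone.2.
Qed.

Lemma interior_coneD u v : K^° u -> K v -> K^° (u + v).
Proof.
move=> /nbhs_translate Ku Kv; apply/nbhs_translate.
by apply: filterS Ku => z /= Kuz; rewrite addrAC; exact: coneD.
Qed.

Lemma interior_coneZ (t : R) u : 0 < t -> K^° u -> K^° (t *: u).
Proof.
move=> t0 /(nbhsZ (lt0r_neq0 t0)); apply: filterS => _ [k Kk <-].
exact: K_cone.2.
Qed.

Lemma interior_cone_ray u v : K^° v -> exists2 s : R, 0 < s &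
  forall l : R, `|l| <= s -> K^° (v + l *: u).
Proof.
move=> Kv; have /nbhs_translate Kv0 : nbhs v K^° by exact: nbhs_interior.
have [d d0 dK] := nbhs_scale_left u Kv0.
by exists d.
Qed.

End cone.

Section order.
Variables (R : realType) (Y : tvsType R) (K : set Y).

Lemma ltK_EFin (u v : Y) : ltK K u%:E v%:E <-> K^° (v - u).
Proof.
split=> [[k Kk /(congr1 -%R)]|Kvu]; first by rewrite opprK opprB => <-.
by exists (v - u); rewrite // opprB.
Qed.

Lemma leK_EFin (u v : Y) : leK K u%:E v%:E <-> K (v - u).
Proof.
split=> [[k Kk /(congr1 -%R)]|Kvu]; first by rewrite opprK opprB => <-.
by exists (v - u); rewrite // opprB.
Qed.

Hypotheses (K_cone : convex_cone K) (K_closed : closed K)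
  (K_int : K^° !=set0).

Lemma plusK_WSup (M : set (\bar Y)) (y : Y) :
  (forall v, M v -> v <> +oo%E) -> (exists v : Y, M v%:E) ->
  plusK (WSup K M) K y%:E <-> forall v : Y, M v%:E -> ~ K^° (v - y).
Proof.
move=> Mfin [y0 My0]; have [e Ke] := K_int; have Ke' := interior_subset Ke.
have K0 : K 0 by apply: cone0 => //; exists e.
split=> [[v0 [v0M _]] [k Kk v0y] v Mv Kvy|ynlt].
  move: v0 v0y v0M => [v0 [v0y] v0M|//|//].
  apply: (v0M v%:E Mv); apply/ltK_EFin.
  have -> : v - v0 = v - y + k by rewrite -v0y opprD addrA subrK.
  exact: interior_coneD.
(* [T] measures how far [y] can be lowered along [e] without falling strictly below an element of
   [M]. *)
pose T : set R :=
  [set t | 0 <= t /\ forall v : Y, M v%:E -> ~ K^° (v - y + t *: e)].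
have T0 : T 0 by split=> // v Mv; rewrite scale0r addr0; exact: ynlt.
have Ke0 (s : R) : 0 <= s -> K (s *: e).
  rewrite le_eqVlt => /predU1P[<-|s0]; first by rewrite scale0r.
  exact: K_cone.2.
have Tub : has_ubound T.
  have [l l0 /(_ l)] := interior_cone_ray (y0 - y) Ke.
  rewrite gtr0_norm// => /(_ (lexx _)) Kl.
  (* Since [e + l *: (y0 - y)] is interior, lowering [y] by more than [l^-1] puts it strictly below
     [y0]. *)
  exists l^-1 => t [t0 /(_ _ My0)]; apply: contra_notT; rewrite -ltNge => lt.
  have -> : y0 - y + t *: e = l^-1 *: (e + l *: (y0 - y)) + (t - l^-1) *: e.
    by have l0' := lt0r_neq0 l0; lmod_eq.
  apply: interior_coneD => //; last by apply: Ke0; rewrite subr_ge0 ltW.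
  by apply: interior_coneZ; rewrite ?invr_gt0.
have Tsup : has_sup T by split=> //; exists 0.
pose t := sup T.
have t0 : 0 <= t by exact: sup_ubound.
exists (y - t *: e)%:E; last first.
  by exists (t *: e); [exact: Ke0|rewrite -[LHS]/((y - t *: e + t *: e)%:E) subrK].
split=> [[v Mv|/Mfin//|_ []]|v1].
  (* Interiority survives the subtraction of [l *: e], whereas some [s] in [T] exceeds [t - l]. *)
  move=> /ltK_EFin; rewrite opprB addrA [_ + _ - y]addrAC => Kt.
  have [l l0 /(_ (- l))] := interior_cone_ray e Kt.
  rewrite normrN gtr0_norm// => /(_ (lexx _)) Kl.
  have [s [_ /(_ _ Mv) Ts] ts] := sup_adherent l0 Tsup.
  apply: Ts; have -> : v - y + s *: e = v - y + t *: e + - l *: e + (s - (t - l)) *: e.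
    by lmod_eq.
  by apply: interior_coneD => //; apply: Ke0; rewrite subr_ge0 ltW.
case: v1 => [v1||]; last 2 first.
- by [].
- by exists y0%:E.
move=> /ltK_EFin Kv1.
have [l l0 /(_ (- l))] := interior_cone_ray e Kv1.
rewrite normrN gtr0_norm// => /(_ (lexx _)) Kl.
(* [v1 + l *: e] is still strictly below [y - t *: e], and some [v] in [M] is strictly above
   [y - (t + l) *: e], hence above [v1]. *)
have : ~ T (t + l).
  by move=> /(sup_ubound Tub); rewrite -/t gerDl leNgt l0.
rewrite /T/= => /not_andP[|/existsNP[v /not_implyP[Mv /contrapT Kv]]].
  by rewrite addr_ge0// ltW.
exists v%:E => //; apply/ltK_EFin.
have -> : v - v1 = (v - y + (t + l) *: e) + (y - t *: e - v1 + - l *: e).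
  by lmod_eq.
by apply: interior_coneD => //; exact: interior_subset.
Qed.

(** Separate the origin from [A], which is [D] enlarged by the interior of [K] in the second
    component. The enlargement provides the core in the direction of [Y], the last hypothesis the
    one in the direction of [Z0]. Dividing by [f (0, e)] normalizes. *)
Lemma multipliers (Z : lmodType R) (Z0 : set Z) (D : set (Z * Y)) (e : Y) :
  K^° e -> linear_subspace Z0 -> @convex_set R (Z * Y)%type D ->
  (forall z w, D (z, w) -> Z0 z) ->
  (forall w, D (0, w) -> ~ K^° (- w)) ->
  (forall z, Z0 z -> exists2 d : R, 0 < d & exists w, D (d *: z, w)) ->
  exists (zs : {linear Z -> R^o}) (ys : {linear Y -> R^o}),
    [/\ forall k, K k -> 0 <= ys k, ys e = 1 &
        forall z w, D (z, w) -> 0 <= zs z + ys w].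
Proof.
move=> Ke lZ0 /convex_setP cD DZ0 Dsep core; have Ke' := interior_subset Ke.
pose A : set (Z * Y) := [set p | exists w k, [/\ D (p.1, w), K^° k & p.2 = w + k]].
have [d0 _ [w0]] := core _ lZ0.1; rewrite scaler0 => Dw0.
have [||||||f [fp fA]] := @separation R (Z * Y)%type [set p | Z0 p.1] A (0, w0 + e).
- by split=> [|a u v Zu Zv]; [exact: lZ0.1|exact: lZ0.2].
- apply/convex_setP => t [z y] [z' y'] t01 [w [k [/= Dw Kk ->]]] [w' [k' [/= Dw' Kk' ->]]].
  exists (t *: w + (1 - t) *: w'), (t *: k + (1 - t) *: k'); split.
  + exact: cD _ _ _ t01 Dw Dw'.
  + have [->|t0] := eqVneq t 0; first by rewrite scale0r add0r subr0 scale1r.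
    apply: interior_coneD => //.
      by apply: interior_coneZ => //; rewrite lt_neqAle eq_sym t0; case/andP: t01.
    have [->|t1] := eqVneq t 1.
      by rewrite subrr scale0r; apply: cone0 => //; exists e.
    apply: K_cone.2; last exact: interior_subset.
    by rewrite subr_gt0 lt_neqAle t1; case/andP: t01.
  + by rewrite /= !scalerDr addrACA.
- by move=> [z y] [w [k [/= Dw _ _]]]; exact: DZ0 Dw.
- move=> [w [k [/= Dw Kk /esym/eqP]]]; rewrite addrC addr_eq0 => /eqP kw.
  by apply: Dsep Dw _; rewrite -kw.
- exact: lZ0.1.
- move=> [z y] /= Zz; have [d d0' [w Dw]] := core z Zz.
  have [s s0 Ks] := interior_cone_ray (w0 + d *: y - w) Ke.
  (* [l <= 1] allows a convex combination of two points of [D], and [l <= s] keeps the perturbed [e]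
     interior. *)
  pose l := Num.min s 1.
  have l0 : 0 < l by rewrite lt_min s0 ltr01.
  exists (l * d); first by rewrite mulr_gt0.
  exists (l *: w + (1 - l) *: w0), (e + l *: (w0 + d *: y - w)); split=> /=.
  + have l01 : 0 <= l <= 1 by rewrite ltW//= ge_min lexx orbT.
    have := cD l _ _ l01 Dw Dw0; congr D; congr (_, _).
    by rewrite -[LHS]/(l *: (d *: z) + (1 - l) *: 0); lmod_eq.
  + by apply: Ks; rewrite gtr0_norm// ge_min lexx.
  + by rewrite -[LHS]/(w0 + e + (l * d) *: y); lmod_eq.
have fD z w z' w' : f (z, w) + f (z', w') = f (z + z', w + w').
  by rewrite -linearD.
have fZ a z w : f (a *: z, a *: w) = a * f (z, w).
  by rewrite -[RHS]/(a *: f (z, w)) -linearZ.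
have fK k : K k -> 0 <= f (0, k).
  move=> Kk; rewrite leNgt; apply/negP => fk.
  (* With this multiple of [k], the form would take the value [1 - 2] on [A]. *)
  have n0 : 0 < - 2 / f (0, k) by rewrite nmulr_rgt0 ?oppr_lt0// invr_lt0.
  have : 0 <= f (0, w0 + e + (- 2 / f (0, k)) *: k).
    apply: fA; exists w0, (e + (- 2 / f (0, k)) *: k); split=> //=.
      by apply: interior_coneD => //; exact: K_cone.2.
    by rewrite addrA.
  have := fZ (- 2 / f (0, k)) 0 k; rewrite scaler0 mulrVK ?unitfE ?lt_eqF// => fk2.
  have := fD 0 (w0 + e) 0 ((- 2 / f (0, k)) *: k); rewrite addr0 fp fk2 => <-.
  by lra.
have fe : 0 < f (0, e).
  (* As [e - s *: (w0 + e)] is in [K], [f (0, e)] is at least [s * f (0, w0 + e) = s]. *)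
  have [s s0 /(_ (- s))] := interior_cone_ray (w0 + e) Ke.
  rewrite normrN gtr0_norm// => /(_ (lexx _)) /interior_subset/fK.
  have := fD 0 e 0 ((- s) *: (w0 + e)); rewrite addr0 => <-.
  have := fZ (- s) 0 (w0 + e); rewrite scaler0 fp mulr1 => ->.
  by rewrite subr_ge0; exact: lt_le_trans.
pose zs z : R^o := f (z, 0) / f (0, e).
pose ys y : R^o := f (0, y) / f (0, e).
have zlin : linear zs.
  move=> a u v; rewrite /zs -[RHS]/(a * _ + _) mulrA -mulrDl -fZ fD.
  by rewrite scaler0 addr0.
have ylin : linear ys.
  move=> a u v; rewrite /ys -[RHS]/(a * _ + _) mulrA -mulrDl -fZ fD.
  by rewrite scaler0 addr0.
pose zL := GRing.isLinear.Build _ _ _ _ zs zlin.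
pose yL := GRing.isLinear.Build _ _ _ _ ys ylin.
pose zsL : {linear Z -> R^o} := HB.pack zs zL.
pose ysL : {linear Y -> R^o} := HB.pack ys yL.
exists zsL, ysL; split=> [k Kk||z w Dzw].
- by rewrite /ysL/= /ys divr_ge0 ?fK// ltW.
- by rewrite /ysL/= /ys mulfV// gt_eqF.
rewrite /zsL/ysL/= /zs /ys -mulrDl fD addr0 add0r divr_ge0 ?(ltW fe)//.
rewrite leNgt; apply/negP => fzw.
(* [f] is known to be nonnegative only on [A]; this [s] gives [(z, w + s *: e)] half of the negative
   value at [(z, w)]. *)
pose s := - f (z, w) / (2 * f (0, e)).
have s0 : 0 < s by rewrite divr_gt0 ?oppr_gt0// mulr_gt0.
have : 0 <= f (z, w + s *: e).
  by apply: fA; exists w, (s *: e); split=> //; exact: interior_coneZ.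
have := fD z w 0 (s *: e); rewrite addr0 => <-.
have := fZ s 0 e; rewrite scaler0 => ->.
rewrite /s invfM mulrA mulrVK ?unitfE ?gt_eqF//.
by rewrite leNgt; lra.
Qed.

End order.

(** * Closed convex relations *)

Lemma closure_convex (R : realType) (E : tvsType R) (A : set E) :
  @convex_set R E A -> @convex_set R E (closure A).
Proof.
move=> /convex_setP cA; apply/convex_setP => t x y t01 Ax Ay.
have [->|t0] := eqVneq t 0; first by rewrite scale0r add0r subr0 scale1r.
have [->|t1] := eqVneq t 1; first by rewrite subrr scale0r addr0 scale1r.
have s0 : 1 - t != 0 by rewrite subr_eq0 eq_sym.
move=> W /nbhs_translate/nbhs0_half[N N0 NW].
have near (r : R) (u : E) : r != 0 -> nbhs u [set z | N (r *: (z - u))].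
  move=> r0; apply/nbhs_translate; apply: filterS (nbhs0_scale r0 N0) => z /=.
  by rewrite [u + z]addrC addrK.
have [a [Aa Na]] := Ax _ (near t x t0); have [b [Ab Nb]] := Ay _ (near _ y s0).
exists (t *: a + (1 - t) *: b); split; first exact: cA.
have := NW _ _ Na Nb; rewrite /=; congr W; lmod_eq.
Qed.

Section first_countable_base.
Variables (R : realType) (E : tvsType R).

Lemma nbhs0_symmetric_convex_half (U : set E) : nbhs 0 U ->
  exists2 V : set E, nbhs 0 V & [/\ @convex_set R E V,
    forall u, V u -> V (- u) & forall u v, V u -> V v -> U (u + v)].
Proof.
move=> /nbhs0_half[N N0 NU].
have [W W0 [/convex_setP cW WN]] := nbhs0_convex N0.
exists (W `&` [set u | W (- u)]).
  by apply: filterI => //; exact: nbhs0_opp.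
split=> [|u [Wu Wu']|u v [Wu _] [Wv _]].
- apply/convex_setP => t u v t01 [Wu Wu'] [Wv Wv']; split; first exact: cW.
  by rewrite /= opprD -!scalerN; exact: cW.
- by split; rewrite /= ?opprK.
- by apply: NU; exact: WN.
Qed.

(** Each set is chosen so that its sum with itself lies in the previous set and in the next member
    of an enumerated base. *)
Lemma first_countable_base (U : set E) : first_countable E -> nbhs 0 U ->
  exists Un : nat -> set E,
    [/\ forall n, nbhs 0 (Un n),
        forall n, @convex_set R E (Un n) /\ (forall u, Un n u -> Un n (- u)),
        forall u v, Un 0%N u -> Un 0%N v -> U (u + v),
        forall n u v, Un n.+1 u -> Un n.+1 v -> Un n (u + v) &
        forall W : set E, nbhs 0 W -> exists n, Un n `<=` W].
Proof.
move=> /(_ 0)[B /countable_injP[f finj] [B0 Bbase]] U0.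
(* [b n] is the member of the base with code [n], or the whole space if there is none. *)
have /choice[b bP] (n : nat) : exists b : set E,
    nbhs 0 b /\ forall V, B V -> f V = n -> b = V.
  have [[V [BV fV]]|noV] := pselect (exists V, B V /\ f V = n); last first.
    exists setT; split=> [|V BV fV]; first exact: filterT.
    by exfalso; apply: noV; exists V.
  exists V; split=> [|W BW fW]; first exact: B0.
  by apply: finj; rewrite ?inE// fV.
have /choice[next nextP] (W : set E) : exists V : set E, nbhs 0 W ->
    nbhs 0 V /\ [/\ @convex_set R E V, forall u, V u -> V (- u) &
    forall u v, V u -> V v -> W (u + v)].
  have [W0|W0] := pselect (nbhs 0 W); last by exists setT.
  by have [V V0 VP] := nbhs0_symmetric_convex_half W0; exists V.
pose Un := fix Un n := if n is n'.+1 then next (Un n' `&` b n') else next U.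
have Un0 n : nbhs 0 (Un n).
  elim: n => [|n IH] /=; first exact: (nextP _ U0).1.
  have Ub : nbhs 0 (Un n `&` b n) by apply: filterI => //; exact: (bP n).1.
  exact: (nextP _ Ub).1.
have Ub n : nbhs 0 (Un n `&` b n) by apply: filterI => //; exact: (bP n).1.
exists Un; split=> //.
- case=> [|n]; first by have [_ []] := nextP _ U0.
  by have [_ []] := nextP _ (Ub n).
- by have [_ []] := nextP _ U0.
- by move=> n u v /= Uu Uv; have [_ [_ _ /(_ _ _ Uu Uv)[]]] := nextP _ (Ub n).
(* The member with code [n] enters at index [n.+1]; adding 0 shows that it contains [Un n.+1]. *)
move=> W /Bbase[V BV VW]; exists (f V).+1 => u /= Uu; apply: VW.
have [_ [_ _ h]] := nextP _ (Ub (f V)).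
have : nbhs 0 (Un (f V).+1) by [].
move=> /nbhs_singleton Un00; have := h _ _ Uu Un00.
by rewrite addr0 => -[_]; rewrite ((bP (f V)).2 V BV erefl).
Qed.

End first_countable_base.

(* Ursescu's theorem. The residuals [r] and the points [(u_n, z_n)] of [G] satisfy
   [r_n = (z_n + r_(n+1)) / 2], so that [z] is the convex combination of the [z_n]
   with weights [2 ^- n.+1], plus [2 ^- n * r n]. The residuals need not tend to
   0: [2 * r n] is only adherent to [B n], which suffices because [G] is closed. *)
Lemma closed_convex_relation_open (R : realType) (E Z : tvsType R)
    (Z0 : set Z) (G : set (E * Z)) (U : set E) :
  tvs_complete E -> first_countable E -> barreled Z0 -> linear_subspace Z0 ->
  closed G -> @convex_set R (E * Z)%type G -> G (0, 0) ->
  (forall u z, G (u, z) -> Z0 z) ->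
  (forall z, Z0 z -> exists2 d : R, 0 < d & exists u, G (u, d *: z)) ->
  nbhs 0 U ->
  exists2 V : set Z, nbhs 0 V &
    forall z, V z -> Z0 z -> exists2 u, U u & G (u, z).
Proof.
move=> Ecomp Efc Zbar lZ0 Gcl /convex_setP cG G0 GZ0 Gabs U0.
have [Un [Un0 UnC UnU UnD Unb]] := first_countable_base Efc U0.
have Un00 n : Un n 0 by exact: nbhs_singleton.
have UnS n u : Un n.+1 u -> Un n u.
  by move=> Uu; rewrite -[u]addr0; exact: UnD.
have UnZ n (t : R) u : 0 <= t <= 1 -> Un n u -> Un n (t *: u).
  move=> t01 Uu; have /convex_setP/(_ t u 0 t01 Uu (Un00 n)) := (UnC n).1.
  by rewrite scaler0 addr0.
have GZ (t : R) u z : 0 <= t <= 1 -> G (u, z) -> G (t *: u, t *: z).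
  move=> t01 Gu; have := cG t (u, z) 0 t01 Gu G0.
  by rewrite scaler0 addr0.
pose B n := [set z | exists2 u, Un n.+1 u & G (u, z)].
(* The part of the closure of [B n] in [Z0] is a barrel; it absorbs in both directions because [B1]
   applies to [z] and to [- z]. *)
have Bcl n : exists V : set Z, nbhs 0 V /\
    forall z, V z -> Z0 z -> closure (B n) z.
  have B1 z : Z0 z -> exists2 d : R, 0 < d & forall l : R, 0 <= l <= d -> B n (l *: z).
    move=> /Gabs[d d0 [u Gu]].
    have [s s0 Us] := nbhs_scale_left u (Un0 n.+1).
    exists (d * Num.min s 1); first by rewrite mulr_gt0// lt_min s0 ltr01.
    move=> l /andP[l0 ld]; exists ((l / d) *: u).
      apply: Us; rewrite ger0_norm ?divr_ge0 ?(ltW d0)//.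
      rewrite ler_pdivrMr// mulrC (le_trans ld)// ler_pM2l//.
      by rewrite ge_min lexx.
    have -> : l *: z = (l / d) *: (d *: z) by rewrite scalerA divfK// gt_eqF.
    apply: GZ => //; rewrite divr_ge0 ?(ltW d0)//= ler_pdivrMr// mul1r.
    by rewrite (le_trans ld)// ger_pMr// ge_min lexx orbT.
  have nB : nbhs (0 : subspace Z0) (closure (B n) `&` Z0).
    apply: Zbar; first exact: subIsetr.
    - move=> z Zz; have [d1 d10 Bd1] := B1 z Zz.
      have [d2 d20 Bd2] := B1 (- z) (linear_subspaceN lZ0 Zz).
      exists (Num.min d1 d2) => [|l]; first by rewrite lt_min d10.
      rewrite le_min => /andP[ld1 ld2]; split; last exact: linear_subspaceZ.
      apply: subset_closure; have [l0|l0] := leP 0 l.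
        by apply: Bd1; rewrite l0 (le_trans (ler_norm l)).
      rewrite -[z]opprK scalerN -scaleNr; apply: Bd2.
      by rewrite oppr_ge0 (ltW l0)/= -(ltr0_norm l0).
    - have cB : @convex_set R Z (B n).
        apply/convex_setP => t x y t01 [u Uu Gx] [v Uv Gy].
        exists (t *: u + (1 - t) *: v); last exact: cG t _ _ t01 Gx Gy.
        by have /convex_setP := (UnC n.+1).1; exact.
      have /convex_setP cclB := closure_convex cB.
      apply/convex_setP => t x y t01 [Bx Zx] [By Zy]; split; first exact: cclB.
      by apply: lZ0.2 => //; exact: linear_subspaceZ.
    - apply/closed_subspaceP; exists (closure (B n)); first exact: closed_closure.
      by rewrite -setIA setIid.
  have nB' : within Z0 (nbhs 0) (closure (B n) `&` Z0).
    by rewrite nbhs_subspace_in//; exact: lZ0.1.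
  exists [set z | Z0 z -> closure (B n) z]; split=> //.
  by apply: filterS nB' => y [].
have [V VP] := choice Bcl.
have V0 n : nbhs 0 (V n) := (VP n).1.
have two0 : (2 : R) != 0 by [].
exists [set z | V 0%N (2 *: z)]; first exact: nbhs0_scale.
move=> z Vz Zz.
(* As [2 *: y] is adherent to [B n], some [b] in [B n] is so close that twice the new residual
   [2 *: y - b] lies in [V n.+1]. *)
have /choice[st stP] (p : nat * Z) : exists q : E * Z,
    Z0 p.2 -> V p.1 (2 *: p.2) ->
    [/\ Un p.1.+1 q.1, G q & V p.1.+1 (2 *: (2 *: p.2 - q.2))].
  case: p => n y /=; have [[Zy Vy]|no] := pselect (Z0 y /\ V n (2 *: y)); last first.
    by exists 0 => Zy Vy; exfalso; apply: no.
  have cly : closure (B n) (2 *: y) by apply: (VP n).2 => //; exact: linear_subspaceZ.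
  have /cly[b [[u Uu Gu] Vb]] : nbhs (2 *: y) [set b | V n.+1 (2 *: (2 *: y - b))].
    apply/nbhs_translate.
    have := nbhs0_scale (_ : - (2 : R) != 0) (V0 n.+1); rewrite oppr_eq0 => /(_ two0).
    by apply: filterS => w /=; congr (V _); lmod_eq.
  by exists (u, b).
pose r := fix r n := if n is n'.+1 then 2 *: r n' - (st (n', r n')).2 else z.
pose s := fix s n :=
  if n is n'.+1 then s n' + (2 ^- n'.+1) *: (st (n', r n')).1 else 0.
have rP n : Z0 (r n) /\ V n (2 *: r n).
  elim: n => [|n [Zr Vr]] //=; have [_ Gst Vst] := stP (n, r n) Zr Vr; split=> //.
  apply: linear_subspaceB => //; first exact: linear_subspaceZ.
  by apply: (GZ0 (st (n, r n)).1); rewrite -surjective_pairing.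
have half01 n : 0 <= (2 : R) ^- n <= 1.
  by rewrite invr_ge0 exprn_ge0//= invf_le1 ?exprn_gt0// exprn_ege1// ler1n.
(* The first [n] weights add up to [1 - 2 ^- n]; an arbitrary point [h] of [G] carries the rest. The
   partial sum in [Z] is [z - 2 ^- n *: r n]. *)
have sG n h : G h -> G (s n + 2 ^- n *: h.1, z - 2 ^- n *: r n + 2 ^- n *: h.2).
  elim: n h => [|n IH] h Gh /=.
    by rewrite expr0 invr1 !scale1r add0r subrr add0r -surjective_pairing.
  have [_ Gst _] := stP (n, r n) (rP n).1 (rP n).2.
  have half : 0 <= (2^-1 : R) <= 1 by lra.
  have := IH _ (cG _ _ _ half Gst Gh); congr (G (_, _)) => /=.
    have e2 : (2 : R) ^- n.+1 = 2 ^- n / 2 by rewrite exprS invfM mulrC.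
    by rewrite e2; lmod_eq.
  have e2 : (2 : R) ^- n.+1 = 2 ^- n / 2 by rewrite exprS invfM mulrC.
  by rewrite e2; lmod_eq.
(* Peeling off the first term leaves a tail in [Un m.+1], so [m] must vary in the induction. *)
have sU m k : Un m (s (k + m)%N - s m).
  elim: k m => [|k IH] m; first by rewrite add0n subrr.
  have -> : s (k.+1 + m)%N - s m =
      (s (k + m.+1)%N - s m.+1) + 2 ^- m.+1 *: (st (m, r m)).1.
    by rewrite addSnnS /=; lmod_eq.
  apply: UnD; first exact: IH.
  apply: UnZ; first exact: half01.
  by have [] := stP (m, r m) (rP m).1 (rP m).2.
have sU' m n : (m <= n)%N -> Un m (s n - s m) by move=> mn; rewrite -(subnK mn).
have [l lP] : exists l : E, forall W, nbhs l W ->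
    exists n0, forall n, (n0 <= n)%N -> W (s n).
  apply: (Ecomp nat (fun m n => (m <= n)%N) s).
    split=> [|//|i j k|i j]; [exact: inhabits 0%N|exact: leq_trans|].
    by exists (maxn i j); rewrite ?leq_maxl ?leq_maxr.
  move=> W /Unb[n UnW]; exists n.+1 => i j ni nj; apply: UnW.
  have -> : s i - s j = (s i - s n.+1) + - (s j - s n.+1) by lmod_eq.
  by apply: UnD; [|apply: (UnC _).2]; exact: sU'.
exists l.
  have : nbhs l [set y | Un 0%N (l - y)].
    apply/nbhs_translate; apply: filterS (nbhs0_opp (Un0 0%N)) => y /=.
    by congr (Un _ _); lmod_eq.
  move=> /lP[n /(_ n (leqnn n)) /= ln].
  have -> : l = (l - s n) + (s n - s 0%N) by rewrite /=; lmod_eq.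
  by apply: UnU => //; exact: sU'.
(* The point of [G] near [(l, z)] comes from [sG], with [h] half of a point [(u, b)] where [b] in
   [B n] is close to [2 *: r n]. *)
apply: Gcl => W [[W1 W2] /= [/nbhs_translate W1l /nbhs_translate W2z] W12].
have [m UmW] := Unb _ W1l.
have : nbhs l [set y | Un m.+1 (y - l)].
  apply/nbhs_translate; apply: filterS (Un0 m.+1) => y /=.
  by congr (Un _ _); lmod_eq.
move=> /lP[n0 ln0]; pose n := maxn n0 m.+1.
have ln : Un m.+1 (s n - l) by apply: ln0; exact: leq_maxl.
have [Zr Vr] := rP n.
have : closure (B n) (2 *: r n) by apply: (VP n).2 => //; exact: linear_subspaceZ.
have n10 : (2 : R) ^- n.+1 != 0 by rewrite invr_eq0 expf_neq0.
have e2 : (2 : R) ^- n.+1 = 2 ^- n / 2 by rewrite exprS invfM mulrC.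
have : nbhs (2 *: r n) [set b | W2 (z + 2 ^- n.+1 *: (b - 2 *: r n))].
  apply/nbhs_translate; apply: filterS (nbhs0_scale n10 W2z) => y /=.
  by congr (W2 _); lmod_eq.
move=> /[swap] /[apply] -[b [[u Uu Gu] W2b]].
have half : 0 <= (2^-1 : R) <= 1 by lra.
have := sG n _ (GZ _ _ _ half Gu) => /= Gn.
exists (s n + 2 ^- n *: (2^-1 *: u), z - 2 ^- n *: r n + 2 ^- n *: (2^-1 *: b)).
split=> //; apply: W12; split=> /=.
  have -> : s n + 2 ^- n *: (2^-1 *: u) = l + ((s n - l) + (2 ^- n / 2) *: u).
    by lmod_eq.
  apply: UmW; apply: UnD => //; rewrite -e2; apply: UnZ; first exact: half01.
  have Udec k : Un (k + m.+1)%N u -> Un m.+1 u by elim: k => // k IH /UnS.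
  by apply: (Udec (n - m)%N); rewrite addnS subnK ?(leq_trans (leqnSn m)) ?leq_maxr.
move: W2b; rewrite /= e2; congr (W2 _); lmod_eq.
Qed.

(** * Perturbation mappings *)

Lemma tvs_complete_prod (R : realType) (X Y : tvsType R) :
  tvs_complete X -> tvs_complete Y -> tvs_complete (X * Y)%type.
Proof.
move=> cX cY I le x dirI xC; have [_ _ tr ub] := dirI.
have [U U0|l1 l1P] := cX I le (fun i => (x i).1) dirI.
  have [|i0 i0P] := xC [set p | U p.1].
    by exists (U, setT) => //=; [split=> //; exact: filterT|move=> p []].
  by exists i0 => i j /i0P h /h.
have [U U0|l2 l2P] := cY I le (fun i => (x i).2) dirI.
  have [|i0 i0P] := xC [set p | U p.2].
    by exists (setT, U) => //=; [split=> //; exact: filterT|move=> p []].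
  by exists i0 => i j /i0P h /h.
exists (l1, l2) => U [[A B] /= [/l1P[i iA] /l2P[j jB]] ABU].
have [k ik jk] := ub i j.
exists k => m km; apply: ABU; split=> /=; [apply: iA|apply: jB].
  exact: tr ik km.
exact: tr jk km.
Qed.

Lemma first_countable_prod (X Y : topologicalType) :
  first_countable X -> first_countable Y -> first_countable (X * Y)%type.
Proof.
move=> fX fY [x y]; have [A cA [Ax Abase]] := fX x.
have [B cB [By Bbase]] := fY y.
exists [set p.1 `*` p.2 | p in A `*` B].
  by apply: (sub_countable (card_image_le _ _)); exact: countableX.
split=> [_ [[a b] [/= Aa Bb] <-]|U [[a b] /= [/Abase[a' Aa' a'a] /Bbase[b' Bb' b'b]] abU]].
  by exists (a, b) => //; split; [exact: Ax|exact: By].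
exists (a' `*` b'); first by exists (a', b').
by move=> p [/= /a'a ? /b'b ?]; exact: abU.
Qed.

(** Links the affine hulls of [ri] and [icr] with [Z0]: given 0, scaling is an affine combination
    and a sum is twice a midpoint. *)
Lemma lin_sub_aff (R : realType) (V : lmodType R) (U : set V) :
  U 0 -> lin U `<=` aff U.
Proof.
move=> U0; have aU0 : aff U 0 by exact: sub_gen_smallest.
have affU : affine_subspace (aff U).
  by move=> a u v Uu Uv A AU; apply: (AU.1); [exact: Uu|exact: Uv].
have affZ (a : R) u : aff U u -> aff U (a *: u).
  by move=> Uu; have := affU a u 0 Uu aU0; rewrite scaler0 addr0.
apply: smallest_sub; last exact: sub_gen_smallest.
split=> // a u v Uu Uv.
have -> : a *: u + v = 2 *: (2^-1 *: (a *: u) + (1 - 2^-1) *: v) by lmod_eq.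
by apply: (affZ); apply: affU => //; exact: affZ.
Qed.

Section perturbation.
Variables (R : realType) (X Y Z : tvsType R) (K : set Y) (Phi : X * Z -> \bar Y).
Hypotheses (Phi_val : forall p, @Yinfty R Y (Phi p)).

Lemma Yinfty_neqNy p : Phi p <> -oo%E.
Proof. by case: (Phi_val p) => [[y _ <-]|->]. Qed.

Lemma epiKP x z y :
  epiK K Phi (x, z, y) <-> exists2 y', Phi (x, z) = y'%:E & K (y - y').
Proof.
split=> [[_ -> [k Kk]]|[y' Phiy' Ky]]; last first.
  exists (Phi (x, z)) => //; exists (y - y') => //.
  by rewrite Phiy' -[LHS]/((y' + (y - y'))%:E) addrC subrK.
rewrite /=; case: (Phi _) => [y' [<-]|//|//]; exists y' => //.
by rewrite addrAC subrr add0r.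
Qed.

Lemma leK_epiK x z y : leK K (Phi (x, z)) y%:E -> epiK K Phi (x, z, y).
Proof.
move=> le; apply/epiKP; move: le; have := @Yinfty_neqNy (x, z).
by case: (Phi _) => [y' _ /leK_EFin|//|//]; exists y'.
Qed.

Hypotheses (K_cone : convex_cone K) (K_closed : closed K)
  (K_int : K^° !=set0).

Lemma epiK_dom x z : dom Phi (x, z) -> exists y, epiK K Phi (x, z, y).
Proof.
rewrite /dom/=; have := @Yinfty_neqNy (x, z).
case E : (Phi _) => [y| |]// _ _; exists y; apply/epiKP; exists y => //.
rewrite subrr; apply: cone0 => //; case: K_int => e /interior_subset; exists e => //.
Qed.

Lemma epiK_proj_dom x z y : epiK K Phi (x, z, y) -> proj_dom Phi z.
Proof. by move=> /epiKP[y' E _]; exists (x, z) => //; rewrite /dom/= E. Qed.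

Hypotheses (Phi_proper : proper_map Phi) (Phi_zero : proj_dom Phi 0).

Lemma epi_conjugateP (T : cont_linear Z Y) (L : cont_linear X Y) y :
  epi_conjugate K Phi T (L, y) <->
  forall x z y', Phi (x, z) = y'%:E -> ~ K^° (L x + T z - y' - y).
Proof.
rewrite /epi_conjugate/= /conjugate.
have fin p : Phi p <> +oo%E -> exists y', Phi p = y'%:E.
  by have := @Yinfty_neqNy p; case: (Phi p) => // y' _ _; exists y'.
apply: iff_trans (plusK_WSup K_cone K_closed K_int _ _ _) _.
- by move=> _ [p _ <-]; have := @Yinfty_neqNy p; case: (Phi p).
- case: Phi_proper => p /fin[y' E]; exists (L p.1 + T p.2 - y'), p => //.
  by rewrite E.
split=> [h x z y' E|h v [[x z] _]].
  by apply: h; exists (x, z) => //; rewrite E.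
have := @Yinfty_neqNy (x, z); case E : (Phi _) => [y'| |]// _ [<-].
exact: h E.
Qed.

Lemma epi_conjugate0P (L : cont_linear X Y) y :
  epi_conjugate0 K Phi (L, y) <->
  forall x y', Phi (x, 0) = y'%:E -> ~ K^° (L x - y' - y).
Proof.
rewrite /epi_conjugate0/= /conjugate0.
have fin p : Phi p <> +oo%E -> exists y', Phi p = y'%:E.
  by have := @Yinfty_neqNy p; case: (Phi p) => // y' _ _; exists y'.
apply: iff_trans (plusK_WSup K_cone K_closed K_int _ _ _) _.
- by move=> _ [x _ <-]; have := @Yinfty_neqNy (x, 0); case: (Phi _).
- case: Phi_zero => [[x z]] /fin[y' E] /= z0; rewrite z0 in E.
  by exists (L x - y'), x => //; rewrite E.
split=> [h x y' E|h v [x _]].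
  by apply: h; exists x => //; rewrite E.
have := @Yinfty_neqNy (x, 0); case E : (Phi _) => [y'| |]// _ [<-].
exact: h E.
Qed.

(** Adding an element of [K] to [+oo] never gives a finite [y]. *)
Lemma epi_conjugate_L_Phi (T : cont_linear Z Y) (L : cont_linear X Y) y :
  epi_conjugate K Phi T (L, y) -> L_Phi K Phi T.
Proof.
move=> [v0 v0T [k _]] vk; exists L => conjT.
by move: vk; have -> : v0 = +oo%E by move: v0T; rewrite /= conjT.
Qed.

End perturbation.

(** * Lagrange multipliers under the qualification conditions *)

Section qualification.
Variables (R : realType) (X Y Z : tvsType R) (K : set Y) (Phi : X * Z -> \bar Y).
Hypotheses (Phi_val : forall p, @Yinfty R Y (Phi p))
  (K_cone : convex_cone K) (K_closed : closed K) (K_int : K^° !=set0)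
  (Phi_convex : K_convex K Phi) (Phi_zero : proj_dom Phi 0).
Variables (L : cont_linear X Y) (y : Y).

Let Z0 := lin (proj_dom Phi).
Let lZ0 : linear_subspace Z0 := @lin_linear R Z (proj_dom Phi).

(** The epigraph of the value function of the perturbed problem, written as a projection because
    infima need not exist in [Y]. *)
Definition lagrangian_epi : set (Z * Y) :=
  [set p | exists x y', epiK K Phi (x, p.1, y') /\ p.2 = y' - L x + y].

Local Notation D := lagrangian_epi.

Lemma lagrangian_epi_convex : @convex_set R (Z * Y)%type D.
Proof.
have /convex_setP cPhi := Phi_convex.
apply/convex_setP => t [z w] [z' w'] t01 [x [v [/= Dv ->]]] [x' [v' [/= Dv' ->]]].
exists (t *: x + (1 - t) *: x'), (t *: v + (1 - t) *: v').
split; first exact: cPhi t _ _ t01 Dv Dv'.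
have -> : L (t *: x + (1 - t) *: x') = t *: L x + (1 - t) *: L x'.
  by rewrite linearD !linearZ.
rewrite -[LHS]/(t *: (v - L x + y) + (1 - t) *: (v' - L x' + y)).
lmod_eq.
Qed.

Lemma lagrangian_epi_upward z w k : K k -> D (z, w) -> D (z, w + k).
Proof.
move=> Kk [x [v [/= /epiKP[v' E Kv] ->]]].
exists x, (v + k); split; last by rewrite /=; lmod_eq.
by apply/epiKP; exists v' => //; rewrite addrAC; exact: coneD.
Qed.

Lemma lagrangian_epi_lin z w : D (z, w) -> Z0 z.
Proof.
by move=> [x [v [/= /epiK_proj_dom Pz _]]]; exact: sub_gen_smallest.
Qed.

Lemma lagrangian_epi_proj_dom z : proj_dom Phi z -> exists w, D (z, w).
Proof.
move=> [[x z'] /(epiK_dom Phi_val K_cone K_closed K_int)[v Dv] /= <-].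
by exists (v - L x + y), x, v.
Qed.

(** A common [w0] bounds [zs] below by [- ys w0] near 0 in [Z0], as [hahn_banach_extension]
    requires. *)
Definition locally_bounded_above : Prop := exists (V : set Z) (w0 : Y),
  nbhs 0 V /\ forall z, V z -> Z0 z -> D (z, w0).

Lemma cond_i_bounded : cond_i K Phi -> locally_bounded_above.
Proof.
move=> [x [v [V [V0 VPhi]]]]; exists V, (v - L x + y); split=> // z Vz Zz.
by exists x, v; split=> //; exact/(leK_epiK Phi_val)/VPhi.
Qed.

(** The points below [v + e] form a neighborhood of [v]. *)
Lemma cond_ii_cond_i : cond_ii Phi -> cond_i K Phi.
Proof.
move=> [x [v [_ cont]]]; have [e Ke] := K_int.
have [|N N0 NP] := cont [set v' | K (v + e - v')].
  apply/nbhs_translate; apply: filterS (nbhs0_opp (proj1 (nbhs_translate _ _) Ke)) => u /=.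
  by congr K; lmod_eq.
exists x, (v + e), N; split=> // z Nz Zz.
by have [v' Kv' ->] := NP z Nz Zz; exact/leK_EFin.
Qed.

(** [closed_convex_relation_open] applies to the epigraph of [Phi], translated by a point over 0 and
    read as a relation from [X * Y] to [Z]; the [icr] condition makes it absorbing. *)
Lemma cond_iv_bounded : cond_iv K Phi -> locally_bounded_above.
Proof.
move=> [[cX fX] [cY fY] barZ clPhi icr0].
have [e Ke] := K_int.
have [[x0 z0] /(epiK_dom Phi_val K_cone K_closed K_int)[v0 Dv0] /= z00] := Phi_zero.
rewrite {}z00 in Dv0.
pose shift (q : X * Y * Z) : X * Z * Y := (x0 + q.1.1, q.2, v0 + q.1.2).
pose G : set (X * Y * Z) := shift @^-1` (epiK K Phi).
(* On [U] the variation of [v - L x] is at most [e], so one bound serves all [z]. *)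
pose U : set (X * Y) := [set q | K (e - q.2 + L q.1)].
have [||||||||||V V0 VG] := @closed_convex_relation_open R (X * Y)%type Z Z0 G U.
- exact: tvs_complete_prod.
- exact: first_countable_prod.
- exact: barZ.
- exact: lZ0.
- apply: closed_comp clPhi => q _.
  have c1 : (x0 + q'.1.1) @[q' --> q] --> x0 + q.1.1.
    apply: (@cvg_comp _ _ _ (fun q : X * Y * Z => q.1.1) (fun x => x0 + x)).
      by apply: (@cvg_comp _ _ _ fst fst); [exact: cvg_fst|exact: cvg_fst].
    exact: translate_continuous.
  have c2 : (v0 + q'.1.2) @[q' --> q] --> v0 + q.1.2.
    apply: (@cvg_comp _ _ _ (fun q : X * Y * Z => q.1.2) (fun v => v0 + v)).
      by apply: (@cvg_comp _ _ _ fst snd); [exact: cvg_fst|exact: cvg_snd].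
    exact: translate_continuous.
  have c3 : q'.2 @[q' --> q] --> q.2 by exact: cvg_snd.
  exact: cvg_pair (cvg_pair c1 c3) c2.
- have /convex_setP cPhi := Phi_convex.
  apply/convex_setP => t q q' t01 Gq Gq'.
  have := cPhi t _ _ t01 Gq Gq'; congr (epiK _ _ (_, _, _)) => /=.
  + rewrite -[LHS]/(t *: (x0 + q.1.1) + (1 - t) *: (x0 + q'.1.1)).
    rewrite -[RHS]/(x0 + (t *: q.1.1 + (1 - t) *: q'.1.1)); lmod_eq.
  + rewrite -[LHS]/(t *: (v0 + q.1.2) + (1 - t) *: (v0 + q'.1.2)).
    rewrite -[RHS]/(v0 + (t *: q.1.2 + (1 - t) *: q'.1.2)); lmod_eq.
- by rewrite /G/shift/= !addr0.
- move=> q z /epiK_proj_dom Pz; exact: sub_gen_smallest.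
- move=> z Zz; have [d d0 dP] := icr0 z (lin_sub_aff Phi_zero Zz).
  exists d => //; have := dP d; rewrite (ltW d0) lexx add0r => /(_ isT).
  move=> [[x z'] /(epiK_dom Phi_val K_cone K_closed K_int)[v Dv] /= z'E].
  by exists (x - x0, v - v0); rewrite /G/shift/= !(addrC _ (_ - _)) !subrK -z'E.
- have /nbhs0_half[N N0 NK] := proj1 (nbhs_translate _ _) Ke.
  exists ([set x | N (L x)], [set v | N (- v)]).
    split; last exact: nbhs0_opp.
    have /= := @cont_linear_continuous _ _ _ L 0 N.
    by rewrite linear0; exact.
  by move=> q [/= Nx Nv]; have := NK _ _ Nv Nx; rewrite /= addrA.
exists V, (v0 + e - L x0 + y); split=> // z Vz Zz.
have [[x v] /= Kxv GD] := VG z Vz Zz.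
have -> : v0 + e - L x0 + y = (v0 + v - L (x0 + x) + y) + (e - v + L x).
  by rewrite linearD; lmod_eq.
apply: lagrangian_epi_upward => //.
by exists (x0 + x), (v0 + v).
Qed.

(* The second clause yields positivity on [S]: there [x] is the point at which
   [Phi x] does not exceed its value at 0 on [- S]. *)
Definition lagrange_multiplier (T : cont_linear Z Y) : Prop :=
  (forall x z y', Phi (x, z) = y'%:E -> ~ K^° (L x + T z - y' - y)) /\
  forall s : Z, (exists x y', forall t : R, 0 < t ->
    epiK K Phi (x, - (t *: s), y')) -> K (T s).

Hypothesis dual_feasible :
  forall x y', Phi (x, 0) = y'%:E -> ~ K^° (L x - y' - y).

Lemma lagrangian_epi_separated w : D (0, w) -> ~ K^° (- w).
Proof.
move=> [x [v [/= /epiKP[v' E Kv] ->]]] Kw.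
apply: (dual_feasible E).
have -> : L x - v' - y = - (v - L x + y) + (v - v') by lmod_eq.
exact: interior_coneD.
Qed.

(** An interior [k] stays in [K] after subtracting a small [s *: e], whence [ys k >= s]. *)
Lemma normalized_positive (ys : {linear Y -> R^o}) (e : Y) :
  (forall k, K k -> 0 <= ys k) -> ys e = 1 ->
  forall k, K^° k -> 0 < ys k.
Proof.
move=> ysK yse k Kk; have [s s0 /(_ (- s))] := interior_cone_ray e Kk.
rewrite normrN gtr0_norm// => /(_ (lexx _))/interior_subset/ysK.
rewrite linearD linearZ/= yse -[_ *: _]/(- s * 1) mulr1 subr_ge0.
exact: lt_le_trans.
Qed.

Lemma lagrange_multiplier_exists :
  cond_i K Phi \/ cond_ii Phi \/ cond_iii Phi \/ cond_iv K Phi \/ cond_v K Phi ->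
  hausdorff_space Z ->
  exists T, lagrange_multiplier T.
Proof.
move=> qual hZ; have [e Ke] := K_int; have Ke' := interior_subset Ke.
have K0 : K 0 by apply: cone0 => //; exists e.
have mult (zs : {linear Z -> R^o}) (ys : {linear Y -> R^o}) (f : {linear Z -> R^o}) :
    (forall k, K k -> 0 <= ys k) -> ys e = 1 ->
    (forall z w, D (z, w) -> 0 <= zs z + ys w) ->
    continuous (f : Z -> R^o) -> (forall z, Z0 z -> f z = zs z) ->
  exists T, lagrange_multiplier T.
  move=> ysK yse zys fcont fzs.
  pose T z := - f z *: e.
  have Tlin : linear T.
    by move=> a u v; rewrite /T linearP opprD scalerDl scalerA mulrN.
  pose TL := GRing.isLinear.Build _ _ _ _ T Tlin.
  pose TT : {linear Z -> Y} := HB.pack T TL.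
  have Tcont : continuous (TT : Z -> Y).
    move=> z; have cN : (- f z' : R^o) @[z' --> z] --> (- f z : R^o).
      exact: cvgN (fcont z).
    have ce : cst e z' @[z' --> z] --> e by exact: cvg_cst.
    apply: (@continuous_comp _ _ _ (fun z => (- f z : R^o, e))
      (fun p : R^o * Y => p.1 *: p.2)); last exact: scale_continuous.
    exact: cvg_pair cN ce.
  exists (ContLinear Tcont); split=> [x z v E|s [x [v Ps]]].
    (* With [w = v - L x + y], [ys] takes the value [- (zs z + ys w)] at this vector, which is not
       positive. *)
    move=> /(normalized_positive ysK yse).
    have Dz : D (z, v - L x + y).
      by exists x, v; split=> //; apply/epiKP; exists v => //; rewrite subrr.
    have := zys _ _ Dz; rewrite -fzs; last exact: lagrangian_epi_lin Dz.
    have -> : L x + TT z - v - y = - (v - L x + y) + (- f z) *: e.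
      by rewrite /TT/= /T; lmod_eq.
    move: (v - L x + y) => w.
    rewrite linearD linearN linearZ/= yse -[_ *: _]/(- f z * 1) mulr1.
    by lra.
  have Dt t : 0 < t -> D (- (t *: s), v - L x + y).
    by move=> t0; exists x, v; split=> //; exact: Ps.
  have Zs : Z0 s.
    have := lagrangian_epi_lin (Dt 1 ltr01); rewrite scale1r.
    by move=> /(linear_subspaceN lZ0); rewrite opprK.
  suff fs : f s <= 0.
    have : 0 <= - f s by rewrite oppr_ge0.
    rewrite /= /T le_eqVlt => /predU1P[<-|?]; first by rewrite scale0r.
    exact: K_cone.2.
  rewrite leNgt; apply/negP => fs.
  set w := v - L x + y in Dt.
  (* For this [t], the sum that should be nonnegative on [D] equals [ys w - |ys w| - 1]. *)
  have t0 : 0 < (`|ys w| + 1) / f s by rewrite divr_gt0// ltr_wpDl.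
  have := zys _ _ (Dt _ t0); rewrite -fzs; last exact: lagrangian_epi_lin (Dt _ t0).
  rewrite linearN linearZ/= -[_ *: _]/(_ * f s) divfK ?gt_eqF//.
  by have := ler_norm (ys w); lra.
have bounded : locally_bounded_above ->
  exists T, lagrange_multiplier T.
  move=> [V [w0 [V0 VD]]].
  have [|zs [ys [ysK yse zys]]] := multipliers K_cone K_closed Ke lZ0
      lagrangian_epi_convex lagrangian_epi_lin lagrangian_epi_separated.
    move=> z Zz; have [d d0 dV] := nbhs_scale_left z V0.
    exists d => //; exists w0; apply: VD; last exact: (linear_subspaceZ lZ0).
    by apply: dV; rewrite gtr0_norm.
  have [|f [fcont fzs]] := @hahn_banach_extension _ _ Z0 V zs (ys w0) lZ0 V0.
    by move=> z Vz Zz; have := zys _ _ (VD z Vz Zz); lra.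
  exact: (mult zs ys f).
case: qual => [/cond_i_bounded/bounded//|].
case=> [/cond_ii_cond_i/cond_i_bounded/bounded//|].
case=> [[[B finB Z0B] ri0]|].
  have [|zs [ys [ysK yse zys]]] := multipliers K_cone K_closed Ke lZ0
      lagrangian_epi_convex lagrangian_epi_lin lagrangian_epi_separated.
    have : within (aff (proj_dom Phi)) (nbhs 0) (proj_dom Phi).
      rewrite nbhs_subspace_in; first exact: ri0.
      exact: sub_gen_smallest.
    rewrite /within/= => nb z Zz; have [d d0 dV] := nbhs_scale_left z nb.
    exists d => //; apply: lagrangian_epi_proj_dom.
    apply: dV; first by rewrite gtr0_norm.
    by apply: lin_sub_aff => //; exact: (linear_subspaceZ lZ0).
  have [f [fcont fzs]] := finite_dim_continuous zs hZ finB.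
  by apply: (mult zs ys f) => // z; rewrite /Z0 Z0B; exact: fzs.
case=> [/cond_iv_bounded/bounded//|[Phi_min _]].
have T0cont : continuous ((\0 : {linear Z -> Y}) : Z -> Y) by exact: cst_continuous.
exists (ContLinear T0cont); split=> [x z v E|s _]; last exact: K0.
have : leK K (Phi (x, 0)) v%:E by rewrite -E; apply: Phi_min; rewrite /dom/= E.
move=> /(leK_epiK Phi_val)/epiKP[v' E' Kv] Kz.
apply: (dual_feasible E').
have -> : L x - v' - y = L x + 0 - v - y + (v - v') by lmod_eq.
exact: interior_coneD.
Qed.

End qualification.

(** * Equality of the epigraphs *)

Theorem theorem3p2 (R : realType) (X Y Z : tvsType R)
  (hausX : hausdorff_space X) (hausY : hausdorff_space Y)
  (hausZ : hausdorff_space Z)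
  (K : set Y) (K_proper : K <> setT) (K_closed : closed K)
  (K_cone : convex_cone K) (K_int : interior K !=set0)
  (S : set Z) (S_nonempty : S !=set0) (S_cone : convex_cone S)
  (Phi : X * Z -> \bar Y) (Phi_val : forall p, @Yinfty R Y (Phi p))
  (Phi_proper : proper_map Phi) (Phi_convex : K_convex K Phi)
  (Phi_zero : proj_dom Phi 0)
  (qualification :
     cond_i K Phi \/ cond_ii Phi \/ cond_iii Phi \/ cond_iv K Phi \/
     cond_v K Phi) :
  epi_conjugate0 K Phi = \bigcup_(T in L_Phi K Phi) epi_conjugate K Phi T
  /\
  ((exists xt : X, dom Phi (xt, 0) /\
      forall z, (-%R @` S) z -> leK K (Phi (xt, z)) (Phi (xt, 0))) ->
   epi_conjugate0 K Phi = \bigcup_(T in L_Phi K Phi) epi_conjugate K Phi T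
   /\
   \bigcup_(T in L_Phi K Phi) epi_conjugate K Phi T =
     \bigcup_(T in L_Phi_plus S K Phi) epi_conjugate K Phi T).
Proof.
(* Weak duality, by restriction to [z = 0]. *)
have sub T : epi_conjugate K Phi T `<=` epi_conjugate0 K Phi.
  move=> [L y] /(epi_conjugateP Phi_val K_cone K_closed K_int Phi_proper) h.
  apply/(epi_conjugate0P Phi_val K_cone K_closed K_int Phi_zero) => x y' E.
  by have := h x 0 y' E; rewrite linear0 addr0.
have dual L y : epi_conjugate0 K Phi (L, y) ->
    exists T, epi_conjugate K Phi T (L, y) /\ lagrange_multiplier K Phi L y T.
  move=> /(epi_conjugate0P Phi_val K_cone K_closed K_int Phi_zero) h.
  have [T TP] := lagrange_multiplier_exists Phi_val K_cone K_closed K_int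
    Phi_convex Phi_zero h qualification hausZ.
  exists T; split=> //.
  by apply/(epi_conjugateP Phi_val K_cone K_closed K_int Phi_proper); exact: TP.1.
have main : epi_conjugate0 K Phi = \bigcup_(T in L_Phi K Phi) epi_conjugate K Phi T.
  apply/seteqP; split=> [[L y] /dual[T [TLy _]]|Ly [T _ /sub//]].
  by exists T => //; exact: epi_conjugate_L_Phi TLy.
split=> // -[xt [xt_dom xtS]]; split=> //.
apply/seteqP; split=> [|Ly [T [TPhi _] TLy]]; last by exists T.
rewrite -main => -[L y] /dual[T [TLy [_ Tpos]]]; exists T => //.
split=> [|_ [s Ss <-]]; first exact: epi_conjugate_L_Phi TLy.
apply: Tpos; have [v E] : exists v, Phi (xt, 0) = v%:E.
  by move: xt_dom; rewrite /dom/=; case: (Phi_val (xt, 0)) => [[v _ <-] _|-> //]; exists v.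
(* On the whole ray [- (t *: s)] the values of [Phi] at [xt] stay below [v]. *)
exists xt, v => t t0; apply: leK_epiK => //; rewrite -E; apply: xtS.
by exists (t *: s) => //; exact: S_cone.2.
Qed.
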